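(* There exists a finitely-generated, torsion-free subgroup of $\mathrm{Homeo}^+(\mathbb{R}^2)$ which is not circularly-orderable.
   Context: $\mathrm{Homeo}^+(\mathbb{R}^2)$ is the group of orientation-preserving homeomorphisms of $\mathbb{R}^2$. A circular order on a set $S$ is a choice of a total order $<_p$ on $S\setminus\{p\}$ for every $p\in S$ such that for all distinct $p,q\in S$ and all $x,y$ distinct from $p,q$, the order of $x$ and $y$ with respect to $<_p$ and $<_q$ is the same unless $x<_p q<_p y$, in which case $y<_q p<_q x$; if $S=\{x,y,z\}$ has exactly three elements, one requires in addition that $y<_x z$ iff $z<_y x$. A group $G$ is circularly-orderable if it admits a circular order as a set which is invariant under left multiplication, i.e. $y<_x z$ iff $gy<_{gx}gz$ for all $g\in G$. *)

(* Defs.v *)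
From HB Require Import structures.
From mathcomp Require Import all_boot all_order all_algebra.
From mathcomp Require Import all_classical all_reals all_analysis.
Import Order.TTheory GRing.Theory Num.Theory.
Import numFieldNormedType.Exports.

Set Implicit Arguments.
Unset Strict Implicit.
Unset Printing Implicit Defensive.

Local Open Scope classical_set_scope.
Local Open Scope ring_scope.

Section CircularOrder.
Variable T : Type.
Implicit Types (S : set T) (lt : T -> T -> T -> Prop).

Definition strict_total_order_on S (r : T -> T -> Prop) : Prop :=
  [/\ forall x, S x -> ~ r x x,
      forall x y z, S x -> S y -> S z -> r x y -> r y z -> r x z
    & forall x y, S x -> S y -> x <> y -> r x y \/ r y x].

(* [lt p x y] stands for x <_p y; it is meaningful only for x, y in S \ {p}.
   "The order of x and y" concerns the unordered pair {x, y}, so the comparison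
   of <_p with <_q is stated with the names x, y chosen such that x <_p y. *)
Definition circular_order S lt : Prop :=
  [/\ forall p, S p -> strict_total_order_on (S `\ p) (lt p),
      forall p q x y, S p -> S q -> S x -> S y -> p <> q ->
        x <> p -> x <> q -> y <> p -> y <> q -> lt p x y ->
        (lt p x q /\ lt p q y -> lt q y p /\ lt q p x) /\
        (~ (lt p x q /\ lt p q y) -> lt q x y)
    & forall x y z, x <> y -> y <> z -> z <> x -> S = [set x; y; z] ->
        (lt x y z <-> lt y z x)].

End CircularOrder.

Section Subgroups.
Variable gT : groupType.
Implicit Types (G A : set gT).
Local Open Scope group_scope.

Definition subgroup G : Prop :=
  [/\ G 1, forall x y, G x -> G y -> G (x * y) & forall x, G x -> G x^-1].

Definition finitely_generated G : Prop :=
  exists2 A, finite_set A & G = smallest subgroup A.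

Definition torsion_free G : Prop :=
  forall x (n : nat), G x -> (0 < n)%N -> x ^+ n = 1 -> x = 1.

Definition circularly_orderable G : Prop :=
  exists2 lt : gT -> gT -> gT -> Prop, circular_order G lt &
    forall g x y z, G g -> G x -> G y -> G z -> y <> x -> z <> x ->
      (lt x y z <-> lt (g * x) (g * y) (g * z)).

End Subgroups.

Section Plane.
Variable R : realType.
Local Notation plane := (R * R)%type.
Implicit Types (c : R -> plane) (p : plane) (h : plane -> plane).

Definition loop_avoiding c p : Prop :=
  [/\ {within `[0, 1], continuous c}, c 0 = c 1 &
      forall t, t \in `[0, 1] -> c t <> p].

(* The loop c has winding number k around p: theta is a continuous choice of
   the polar angle of c - p, and rho is the polar radius. *)
Definition winding_number c p (k : int) : Prop :=
  exists rho theta : R -> R,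
    [/\ {within `[0, 1], continuous theta},
        forall t, t \in `[0, 1] -> 0 < rho t /\
          c t = (p.1 + rho t * cos (theta t), p.2 + rho t * sin (theta t))
      & theta 1 - theta 0 = 2 * pi * k%:~R].

Definition homeomorphism h : Prop :=
  continuous h /\
  exists g : plane -> plane, [/\ continuous g, cancel h g & cancel g h].

(* At every point p, h carries the local orientation at p to the one at h p,
   that is, the isomorphism H_1(R^2 \ p) -> H_1(R^2 \ h p) induced by h is
   compatible with the identifications of both groups with Z given by the
   winding number. *)
Definition orientation_preserving h : Prop :=
  forall c p, loop_avoiding c p ->
    forall k, winding_number c p k <-> winding_number (h \o c) (h p) k.

Record homeo_plus := HomeoPlus {
  homeo_fun :> plane -> plane;
  homeo_funP : homeomorphism homeo_fun /\ orientation_preserving homeo_fun }.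

HB.instance Definition _ := gen_eqMixin homeo_plus.
HB.instance Definition _ := gen_choiceMixin homeo_plus.

Lemma homeo_plus_ext (f g : homeo_plus) : f =1 g -> f = g.
Proof.
case: f g => [f fP] [g gP] /= /funext fg; subst g.
by congr HomeoPlus; apply: Prop_irrelevance.
Qed.

Lemma loop_avoiding_comp h c p : continuous h -> injective h ->
  loop_avoiding c p -> loop_avoiding (h \o c) (h p).
Proof.
move=> hc hi [cc c01 cp]; split.
- by move=> x; apply: (@continuous_comp (subspace _) _ _ c h x); [exact: cc | exact: hc].
- by rewrite /= c01.
- by move=> t /cp ctp /hi.
Qed.

Lemma homeo_id_subproof :
  homeomorphism (idfun : plane -> plane) /\
  orientation_preserving (idfun : plane -> plane).
Proof.
split; last by [].
have idc : continuous (idfun : plane -> plane) by move=> x; exact: cvg_id.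
by split=> //; exists idfun.
Qed.

Definition homeo_id := HomeoPlus homeo_id_subproof.

Lemma homeo_comp_subproof (f g : homeo_plus) :
  homeomorphism (f \o g) /\ orientation_preserving (f \o g).
Proof.
case: f g => [f [[fc [f' [f'c fK f'K]]] fo]] [g [[gc [g' [g'c gK g'K]]] go]] /=.
split.
  split; first by move=> x; apply: continuous_comp; [exact: gc | exact: fc].
  exists (g' \o f'); split.
  - by move=> x; apply: continuous_comp; [exact: f'c | exact: g'c].
  - by move=> x; rewrite /= fK gK.
  - by move=> x; rewrite /= g'K f'K.
move=> c p cp k; rewrite (go _ _ cp k).
exact: fo (loop_avoiding_comp gc (can_inj gK) cp) k.
Qed.

Definition homeo_comp (f g : homeo_plus) : homeo_plus :=
  HomeoPlus (homeo_comp_subproof f g).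

Lemma homeo_inv_exists (f : homeo_plus) :
  exists g : homeo_plus, cancel f g /\ cancel g f.
Proof.
case: f => [f [[fc [g [gc fK gK]]] fo]] /=.
have gP : homeomorphism g /\ orientation_preserving g.
  split; first by split=> //; exists f.
  move=> c p cp k.
  rewrite (fo _ _ (loop_avoiding_comp gc (can_inj gK) cp) k) gK.
  by have -> : f \o (g \o c) = c by apply/funext => t; rewrite /= gK.
by exists (HomeoPlus gP).
Qed.

Definition homeo_inv (f : homeo_plus) : homeo_plus :=
  projT1 (cid (homeo_inv_exists f)).

Lemma homeo_compA : associative homeo_comp.
Proof. by move=> f g h; apply: homeo_plus_ext. Qed.

Lemma homeo_comp1l : left_id homeo_id homeo_comp.
Proof. by move=> f; apply: homeo_plus_ext. Qed.

Lemma homeo_comp1r : right_id homeo_id homeo_comp.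
Proof. by move=> f; apply: homeo_plus_ext. Qed.

Lemma homeo_compVl : left_inverse homeo_id homeo_inv homeo_comp.
Proof.
move=> f; apply: homeo_plus_ext => x.
by rewrite /= /homeo_inv; case: cid => g [fK gK] /=; rewrite fK.
Qed.

Lemma homeo_compVr : right_inverse homeo_id homeo_inv homeo_comp.
Proof.
move=> f; apply: homeo_plus_ext => x.
by rewrite /= /homeo_inv; case: cid => g [fK gK] /=; rewrite gK.
Qed.

HB.instance Definition _ := isGroup.Build homeo_plus
  homeo_compA homeo_comp1l homeo_comp1r homeo_compVl homeo_compVr.

End Plane.

(* Main.v *)
Require Import Defs.
From HB Require Import structures.
From mathcomp Require Import all_boot all_order all_algebra.
From mathcomp Require Import all_classical all_reals all_analysis.
From mathcomp Require Import ring lra zify.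
Import Order.TTheory GRing.Theory Num.Theory.
Import numFieldNormedType.Exports.

Set Implicit Arguments.
Unset Strict Implicit.
Unset Printing Implicit Defensive.

Local Open Scope classical_set_scope.
Local Open Scope ring_scope.

(* A circular order on G yields a central extension of G by Z carrying a left
   order for which the central generator is cofinal.  In the extension a
   commutator has bounded level, so an element b = [c, d] commuting with d has
   b^n = [c, d^n] and hence translation number zero; likewise for a = [e, c] when
   e commutes with c e c^-1.  If moreover a b^2 a^-1 = b^-2 and
   b a^2 b^-1 = a^-2, the translation numbers force these relations to lift to
   the left-ordered extension, where they imply (ab)^2 (ba)^2 = 1 for all choices
   of signs of the exponents of a and b, so that b = 1.

   In the plane let c be the scaling by e and d a spiral twist turning the circle
   of radius e^u by the angle pi u; then [c, d] is the half-turn up to what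
   happens in small lenses centred at the points +-e^k, which the twist turns by
   multiples of pi.  Inside the lenses the Klein bottle group
   <p, y | p y p^-1 = y^-1> acts by homeomorphisms fixing the boundary, and d is
   corrected there by powers of y so that b has infinite order, while e acts by
   p^{+-1} in every other pair of opposite lenses.  A parity count of the
   exponents of y shows that no element inducing the half-turn is an involution,
   so <c, d, e> is torsion-free. *)

(** * Circular orders and their central extensions *)

Section BasedOrder.
Variables (T : Type) (S : set T) (lt : T -> T -> T -> Prop).
Hypothesis lt_circ : circular_order S lt.
Hypothesis S_large : forall x y z, exists2 q, S q & [/\ q <> x, q <> y & q <> z].

Lemma circ_irr p x : S p -> S x -> x <> p -> ~ lt p x x.
Proof. by case: lt_circ => H _ _ Sp Sx xp; case: (H p Sp) => irr _ _; apply: irr. Qed.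

Lemma circ_trans p x y z : S p -> S x -> S y -> S z ->
  x <> p -> y <> p -> z <> p -> lt p x y -> lt p y z -> lt p x z.
Proof.
case: lt_circ => H _ _ Sp Sx Sy Sz xp yp zp; case: (H p Sp) => _ tr _.
by apply: tr.
Qed.

Lemma circ_total p x y : S p -> S x -> S y -> x <> p -> y <> p -> x <> y ->
  lt p x y \/ lt p y x.
Proof. by case: lt_circ => H _ _ Sp Sx Sy xp yp xy; case: (H p Sp) => _ _; apply. Qed.

Lemma circ_asym p x y : S p -> S x -> S y -> x <> p -> y <> p ->
  lt p x y -> ~ lt p y x.
Proof.
move=> Sp Sx Sy xp yp xy yx; apply: (circ_irr Sp Sx xp).
exact: (circ_trans Sp Sx Sy Sx).
Qed.

Lemma circ_between p q x y : S p -> S q -> S x -> S y -> p <> q ->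
  x <> p -> x <> q -> y <> p -> y <> q -> lt p x q -> lt p q y ->
  lt q y p /\ lt q p x.
Proof.
case: lt_circ => _ H _ Sp Sq Sx Sy pq xp xq yp yq xltq qlty.
have xlty : lt p x y by apply: (circ_trans Sp Sx Sq Sy xp _ yp) => //; apply/nesym.
by case: (H p q x y Sp Sq Sx Sy pq xp xq yp yq xlty) => + _; apply.
Qed.

Lemma circ_rebase p q x y : S p -> S q -> S x -> S y -> p <> q ->
  x <> p -> x <> q -> y <> p -> y <> q ->
  lt p x y -> lt p q x \/ lt p y q -> lt q x y.
Proof.
case: lt_circ => _ H _ Sp Sq Sx Sy pq xp xq yp yq xlty out.
have qp := nesym pq.
case: (H p q x y Sp Sq Sx Sy pq xp xq yp yq xlty) => _; apply=> -[xltq qlty].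
by case: out => [qltx|yltq];
  [apply: (circ_asym Sp Sx Sq xp qp xltq)|apply: (circ_asym Sp Sq Sy qp yp qlty)].
Qed.

(** Cyclic symmetry is an axiom only for three-element sets. Here it comes from a fourth point [q],
    placed before, between or after [x] and [y] in the order based at [p], by changing base
    points. *)
Lemma circ_rot p x y : S p -> S x -> S y -> x <> p -> y <> p ->
  x <> y -> lt p x y -> lt x y p.
Proof.
move=> Sp Sx Sy xp yp xy pxy.
have [q Sq [qp qx qy]] := S_large p x y.
have nxp := nesym xp; have nyp := nesym yp; have nxy := nesym xy.
have nqp := nesym qp; have nqx := nesym qx; have nqy := nesym qy.
have [pxq|pqx] := circ_total Sp Sx Sq xp qp nqx; last first.
  by apply: (proj1 (circ_between Sp Sx Sq Sy _ _ _ _ _ pqx pxy)).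
have [pqy|pyq] := circ_total Sp Sq Sy qp yp qy.
  have [qyp qpx] := circ_between Sp Sq Sx Sy nqp xp nqx yp nqy pxq pqy.
  by apply: (circ_rebase Sq Sx Sy Sp) => //; right.
have [yqp ypx] := circ_between Sp Sy Sx Sq nyp xp xy qp qy pxy pyq.
have xqp : lt x q p by apply: (circ_rebase Sy Sx Sq Sp) => //; right.
have xyq : lt x y q by apply: (circ_rebase Sp Sx Sy Sq) => //; left.
exact: (circ_trans Sx Sy Sq Sp).
Qed.

(** The circle cut open at [p]: adding [p] as least element turns the order based at [p] into a
    linear order of the whole set. *)
Definition based_lt p x y : bool := `[< y <> p /\ (x = p \/ lt p x y) >].

Lemma based_ltn p x : based_lt p x p = false.
Proof. by apply/asboolP => -[]. Qed.

Lemma based_lt0 p y : y <> p -> based_lt p p y.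
Proof. by move=> yp; apply/asboolP; split=> //; left. Qed.

Lemma based_ltE p x y : x <> p -> y <> p -> based_lt p x y = `[< lt p x y >].
Proof.
by move=> xp yp; apply/asboolP/asboolP => [[_ []]//|?]; split=> //; right.
Qed.

Lemma based_ltxx p x : S p -> S x -> based_lt p x x = false.
Proof.
move=> Sp Sx; have [->|xp] := EM (x = p); first exact: based_ltn.
by rewrite based_ltE//; apply/asboolP; apply: circ_irr.
Qed.

Lemma based_lt_asym p x y : S p -> S x -> S y -> x <> y ->
  based_lt p y x = ~~ based_lt p x y.
Proof.
move=> Sp Sx Sy xy.
have [xp|xp] := EM (x = p).
  by subst x; rewrite based_ltn based_lt0//; apply/nesym.
have [yp|yp] := EM (y = p).
  by subst y; rewrite based_ltn based_lt0.
rewrite !based_ltE//; apply/asboolP/asboolPn => [yx|nxy].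
  exact: circ_asym yx.
by case: (circ_total Sp Sx Sy xp yp xy).
Qed.

Lemma based_lt_rot p x y : S p -> S x -> S y -> x <> p -> y <> p ->
  x <> y -> based_lt p x y = based_lt x y p.
Proof.
move=> Sp Sx Sy xp yp xy.
have nxp := nesym xp; have nyp := nesym yp; have nxy := nesym xy.
rewrite !based_ltE//; apply/asboolP/asboolP => [|H]; first exact: circ_rot.
apply: (circ_rot Sy Sp Sx) => //.
exact: (circ_rot Sx Sy Sp).
Qed.

(** The left side counts how often the positive arcs from [u] to [v] and from [v] to [w] pass [o],
    arrival included. Together they form the arc from [u] to [w], plus a full turn exactly when [w]
    comes before [v] as seen from [u]. *)
Lemma based_lt_cocycle o u v w : S o -> S u -> S v -> S w ->
  (based_lt o v u + based_lt o w v = based_lt o w u + based_lt u w v)%N.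
Proof.
move=> So Su Sv Sw.
have [uo|uo] := EM (u = o); first by subst u; rewrite !based_ltn.
have [vu|vu] := EM (v = u).
  by subst v; rewrite based_ltxx// based_ltn addn0.
have [wv|wv] := EM (w = v).
  by subst w; rewrite !based_ltxx.
have [wu|wu] := EM (w = u).
  subst w; rewrite based_ltxx// (based_lt0 vu) (@based_lt_asym o v u)//.
  by case: based_lt.
have [vo|vo] := EM (v = o).
  subst v; rewrite (based_lt0 uo) based_ltn -(based_lt_rot So Su Sw uo wv)//; last exact/nesym.
  by rewrite (@based_lt_asym o w u)//; case: based_lt.
have [wo|wo] := EM (w = o).
  subst w; rewrite (based_lt0 uo) (based_lt0 vo) addnC (@based_lt_asym u v o)//.
  rewrite -(based_lt_rot So Su Sv)//; last exact/nesym.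
  by rewrite (@based_lt_asym o v u)//; case: based_lt.
have ou := nesym uo; have uv := nesym vu; have vw := nesym wv.
have uw := nesym wu; have ov := nesym vo; have ow := nesym wo.
have := circ_total So Sv Su vo uo vu; have := circ_total So Sw Sv wo vo wv.
have := circ_total So Sw Su wo uo wu.
have -> : based_lt o v u = `[< lt o v u >] by exact: based_ltE.
have -> : based_lt o w v = `[< lt o w v >] by exact: based_ltE.
have -> : based_lt o w u = `[< lt o w u >] by exact: based_ltE.
have -> : based_lt u w v = `[< lt u w v >] by exact: based_ltE.
have na x y : S x -> S y -> x <> o -> y <> o -> lt o x y -> `[< lt o y x >] = false.
  by move=> Sx Sy xo yo H; apply/asboolPn; apply: circ_asym H.
have nau x y : S x -> S y -> x <> u -> y <> u -> lt u x y -> `[< lt u y x >] = false.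
  by move=> Sx Sy xo yo H; apply/asboolPn; apply: circ_asym H.
(* Six of the eight cases are the linear orders of three distinct points; the two cyclic ones
   contradict transitivity. *)
move=> [wltu|ultw] [wltv|vltw] [vltu|ultv].
- have H : lt u w v by apply: (circ_rebase So Su Sw Sv) => //; right.
  by rewrite !asboolT.
- have [H3 H4] := circ_between So Su Sw Sv ou wo wu vo vu wltu ultv.
  rewrite (asboolT wltv) (asboolT wltu) (na u v)//= (nau v w)//.
  exact: (circ_trans Su Sv So Sw).
- have H : lt u v w by apply: (circ_rebase So Su Sv Sw) => //; right.
  by rewrite (asboolT vltu) (asboolT wltu) (na v w)// (nau v w).
- have H := circ_trans So Su Sv Sw uo vo wo ultv vltw.
  by case: (circ_asym So Sw Su wo uo wltu).
- have H := circ_trans So Sw Sv Su wo vo uo wltv vltu.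
  by case: (circ_asym So Su Sw uo wo ultw).
- have H : lt u w v by apply: (circ_rebase So Su Sw Sv) => //; left.
  by rewrite (asboolT H) (asboolT wltv) (na u v)// (na u w).
- have [H3 H4] := circ_between So Su Sv Sw ou vo vu wo wu vltu ultw.
  have H : lt u w v by apply: (circ_trans Su Sw So Sv).
  by rewrite (asboolT H) (asboolT vltu) (na v w)// (na u w).
- have H : lt u v w by apply: (circ_rebase So Su Sv Sw) => //; left.
  by rewrite (na u v)// (na v w)// (na u w)// (nau v w).
Qed.

End BasedOrder.

Record circ_group (gT : groupType) := CircGroup {
  cg_set : set gT;
  cg_lt : gT -> gT -> gT -> Prop;
  cg_subgroup : subgroup cg_set;
  cg_circ : circular_order cg_set cg_lt;
  cg_inv : forall g x y z, cg_set g -> cg_set x -> cg_set y -> cg_set z ->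
    y <> x -> z <> x ->
    (cg_lt x y z <-> cg_lt (g * x)%g (g * y)%g (g * z)%g);
  cg_large : forall x y z, exists2 q, cg_set q & [/\ q <> x, q <> y & q <> z] }.

(** * The central extension by the Euler cocycle and its left order *)

Section CentralExtension.
Variables (gT : groupType) (C : circ_group gT).

Record cext := Cext { lvl : int; elt : gT; eltP : cg_set C elt }.

HB.instance Definition _ := gen_eqMixin cext.
HB.instance Definition _ := gen_choiceMixin cext.

Lemma cext_ext x y : lvl x = lvl y -> elt x = elt y -> x = y.
Proof.
case: x y => [n g gP] [m h hP] /= nm gh; subst m h.
by congr Cext; apply: Prop_irrelevance.
Qed.

Lemma cg1 : cg_set C 1%g. Proof. by case: (cg_subgroup C). Qed.

Lemma cgM x y : cg_set C x -> cg_set C y -> cg_set C (x * y)%g.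
Proof. by case: (cg_subgroup C) => _ H _; apply: H. Qed.

Lemma cgV x : cg_set C x -> cg_set C x^-1%g.
Proof. by case: (cg_subgroup C) => _ _; apply. Qed.

(* The Euler cocycle of the circular order; it takes values in {0, 1}, which
   makes [lvl] a quasimorphism and {lvl >= 0} the positive cone of a left order
   on the central extension. *)
Definition wrap (g h : gT) : bool := based_lt (cg_lt C) 1%g (g * h)%g g.

(** This is [based_lt_cocycle] at base point 1 for the points [g], [g * h], [g * h * k]; left
    invariance moves the remaining term from base point [g] back to 1. *)
Lemma wrap_cocycle g h k : cg_set C g -> cg_set C h -> cg_set C k ->
  (wrap g h + wrap (g * h)%g k = wrap g (h * k)%g + wrap h k)%N.
Proof.
move=> Gg Gh Gk; rewrite /wrap.
have -> : based_lt (cg_lt C) 1%g (h * k)%g h =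
    based_lt (cg_lt C) g (g * (h * k))%g (g * h)%g; last first.
  rewrite -mulgA; apply: (based_lt_cocycle (cg_circ C) (@cg_large _ C)) => //.
  - exact: cg1.
  - exact: cgM.
  - by apply: cgM => //; apply: cgM.
rewrite /based_lt; apply/asbool_equiv_eq.
have g1 x : (g * x)%g = g -> x = 1%g.
  by move=> gx; apply: (mulgI g); rewrite gx mulg1.
have ltg x y : cg_set C x -> cg_set C y -> x <> 1%g -> y <> 1%g ->
    cg_lt C 1%g x y <-> cg_lt C g (g * x)%g (g * y)%g.
  move=> Gx Gy x1 y1; have := cg_inv Gg cg1 Gx Gy x1 y1.
  by rewrite mulg1.
split=> -[h1 hk].
  split; first by move=> /g1.
  case: hk => [->|hk]; first by left; rewrite mulg1.
  have [->|hk1] := EM (h * k = 1)%g; first by left; rewrite mulg1.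
  by right; apply/ltg => //; apply: cgM.
have h1' : h <> 1%g by move=> h1'; apply: h1; rewrite h1' mulg1.
split=> //; case: hk => [/g1|hk]; first by left.
have [->|hk1] := EM (h * k = 1)%g; first by left.
by right; apply/ltg => //; apply: cgM.
Qed.

Definition cext_one : cext := Cext 0 cg1.
Definition cext_mul (x y : cext) : cext :=
  Cext (lvl x + lvl y + (wrap (elt x) (elt y))%:Z) (cgM (eltP x) (eltP y)).
Definition cext_inv (x : cext) : cext :=
  Cext (- lvl x - (wrap (elt x) (elt x)^-1%g)%:Z) (cgV (eltP x)).

Lemma wrap1l g : wrap 1%g g = false.
Proof. exact: based_ltn. Qed.

Lemma wrap1r g : cg_set C g -> wrap g 1%g = false.
Proof. by move=> Gg; rewrite /wrap mulg1 (based_ltxx (cg_circ C))//; apply: cg1. Qed.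

Lemma wrapV g : wrap g g^-1%g = `[< g <> 1%g >].
Proof.
rewrite /wrap mulgV; apply/asboolP/asboolP => [[]//|g1]; by split=> //; left.
Qed.

Lemma cext_mulA : associative cext_mul.
Proof.
move=> x y z; apply: cext_ext => /=; last by rewrite mulgA.
have := wrap_cocycle (eltP x) (eltP y) (eltP z); lia.
Qed.

Lemma cext_mul1 : left_id cext_one cext_mul.
Proof.
by move=> x; apply: cext_ext => /=; rewrite ?mul1g// wrap1l add0r addr0.
Qed.

Lemma cext_mul1r : right_id cext_one cext_mul.
Proof.
by move=> x; apply: cext_ext => /=; rewrite ?mulg1// wrap1r ?addr0//; apply: eltP.
Qed.

Lemma cext_mulV : right_inverse cext_one cext_inv cext_mul.
Proof.
by move=> x; apply: cext_ext => /=; [lia|rewrite mulgV].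
Qed.

Lemma cext_mulVl : left_inverse cext_one cext_inv cext_mul.
Proof.
move=> x; apply: cext_ext => /=; last by rewrite mulVg.
have -> : wrap (elt x)^-1%g (elt x) = wrap (elt x) (elt x)^-1%g.
  rewrite /wrap mulgV mulVg; apply/asbool_equiv_eq.
  split=> -[x1 _]; split; [| by left | | by left].
    by move=> e; apply: x1; rewrite e invg1.
  by move=> e; apply: x1; rewrite -[elt x]invgK e invg1.
lia.
Qed.

HB.instance Definition _ := isGroup.Build cext
  cext_mulA cext_mul1 cext_mul1r cext_mulVl cext_mulV.

Local Open Scope group_scope.
Implicit Types x y z : cext.

Lemma eltM x y : elt (x * y) = elt x * elt y. Proof. by []. Qed.
Lemma eltV x : elt x^-1 = (elt x)^-1. Proof. by []. Qed.

Lemma lvlM x y : (lvl x + lvl y <= lvl (x * y)%g <= lvl x + lvl y + 1)%R.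
Proof. by rewrite /= ; case: (wrap _ _); lia. Qed.

Lemma lvlV x : (- lvl x - 1 <= lvl x^-1%g <= - lvl x)%R.
Proof. by rewrite /= ; case: (wrap _ _); lia. Qed.

Definition shift (m : int) : cext := Cext m cg1.

Lemma shift_mul m x : shift m * x = x * shift m.
Proof.
apply: cext_ext => /=; last by rewrite mul1g mulg1.
rewrite wrap1l wrap1r; [lia|exact: eltP].
Qed.

Lemma shiftD m n : shift m * shift n = shift (m + n)%R.
Proof. by apply: cext_ext => /=; rewrite ?mulg1// wrap1l; lia. Qed.

Lemma shift0 : shift 0 = 1. Proof. exact: cext_ext. Qed.

Lemma shiftX m n : shift m ^+ n = shift (m * n%:Z)%R.
Proof.
elim: n => [|n IH]; first by rewrite mulr0 shift0.
rewrite expgS IH shiftD; congr shift; lia.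
Qed.

Lemma elt_eq_shift x y : elt x = elt y -> exists m, x = shift m * y.
Proof.
move=> xy; exists (lvl x - lvl y)%R; apply: cext_ext => /=; rewrite ?mul1g// wrap1l; lia.
Qed.

Lemma lvl_comm_bound x y : (-2 <= lvl (x * y * x^-1 * y^-1)%g <= 3)%R.
Proof.
have := lvlM (x * y * x^-1) y^-1; have := lvlM (x * y) x^-1.
have := lvlM x y; have := lvlV x; have := lvlV y; lia.
Qed.

Lemma shift_bounded m (K : int) :
  (forall n : nat, (`|lvl (shift (m * n%:Z)%R)| <= K)%R) -> m = 0%R.
Proof.
move=> H; have := H 0%N; have := H (`|K| + 1)%N; rewrite /=; nia.
Qed.

(** The lifts commute up to some [shift m], so the commutator of [x ^+ n] with [y] is
    [shift (m * n)]. Levels of commutators are bounded, which forces [m = 0]. *)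
Lemma commute_lift x y : commute (elt x) (elt y) -> commute x y.
Proof.
move=> xy; have [m E] : exists m, x * y = shift m * (y * x).
  by apply: elt_eq_shift; rewrite !eltM xy.
suff m0 : m = 0%R by rewrite /commute E m0 shift0 mul1g.
have E2 n : x ^+ n * y = shift (m * n%:Z)%R * y * x ^+ n.
  elim: n => [|n IH]; first by rewrite mulr0 shift0 !mul1g mulg1.
  have -> : shift (m * n.+1%:Z)%R = shift (m * n%:Z)%R * shift m.
    by rewrite shiftD; congr shift; lia.
  rewrite [in LHS]expgS -mulgA IH !mulgA -(shift_mul (m * n%:Z)) -!mulgA.
  by congr (_ * _); rewrite [x * _]mulgA E -!mulgA -expgS.
apply: (@shift_bounded m 3) => n.
have -> : shift (m * n%:Z)%R = x ^+ n * y * (x ^+ n)^-1 * y^-1.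
  by rewrite E2 mulgK mulgK.
have := lvl_comm_bound (x ^+ n) y; move: (lvl _) => t; lia.
Qed.

(* The elements of translation number zero. *)
Definition slow x := exists K : int, forall n : nat, (`|lvl (x ^+ n)%g| <= K)%R.

(** If the relation lifts up to [shift m], then [shift (m * n)] is the commutator of [x] and
    [y ^+ n] times [y ^+ (n + n)]. Both factors have bounded level, the second because [y] is slow,
    so [m = 0]. *)
Lemma conj_inv_lift x y : slow y ->
  elt x * elt y * (elt x)^-1 = (elt y)^-1 -> x * y * x^-1 = y^-1.
Proof.
move=> [K yK] xy; have [m E] : exists m, x * y * x^-1 = shift m * y^-1.
  by apply: elt_eq_shift; rewrite !eltM !eltV xy.
suff m0 : m = 0%R by rewrite E m0 shift0 mul1g.
apply: (@shift_bounded m (K + 5)) => n.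
have E2 : x * y ^+ n * x^-1 = shift (m * n%:Z)%R * (y ^+ n)^-1.
  have -> : x * y ^+ n * x^-1 = (x * y * x^-1) ^+ n.
    by have := conjXg y x^-1 n; rewrite !conjgE invgK !mulgA.
  by rewrite E expgMn ?expVgn ?shiftX//; apply: shift_mul.
have -> : shift (m * n%:Z)%R = (x * y ^+ n * x^-1 * (y ^+ n)^-1) * y ^+ (n + n).
  by rewrite E2 expgnDr !mulgA mulgVK mulgVK.
have := lvlM (x * y ^+ n * x^-1 * (y ^+ n)^-1) (y ^+ (n + n)).
have := yK (n + n)%N; have := lvl_comm_bound x (y ^+ n).
set s := (X in lvl X); move: (lvl s) => ?; move: (lvl (s * _)) (lvl (y ^+ _)) => ? ?.
lia.
Qed.

Lemma slowX x k : slow x -> slow (x ^+ k).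
Proof. by move=> [K xK]; exists K => n; rewrite -expgnA. Qed.

(** Writing b for the commutator, b y is the conjugate of [y] by [x]. Since b commutes with [y],
    taking n-th powers shows that b^n is the commutator of [x] and [y ^+ n], whose level is
    bounded. *)
Lemma slow_comm_of_commute x y :
  commute (x * y * x^-1 * y^-1) y -> slow (x * y * x^-1 * y^-1).
Proof.
set b := (X in commute X _) => by_; exists 3%R => n.
have -> : b ^+ n = x * y ^+ n * x^-1 * (y ^+ n)^-1.
  have <- : (b * y) ^+ n = x * y ^+ n * x^-1.
    rewrite /b mulgVK; have := conjXg y x^-1 n.
    by rewrite !conjgE invgK !mulgA.
  by rewrite (expgMn n by_) mulgK.
have := lvl_comm_bound x (y ^+ n); move: (lvl _) => t; lia.
Qed.

Lemma slowV x : slow x -> slow x^-1.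
Proof.
move=> [K xK]; exists (K + 1)%R => n; rewrite expVgn.
have := lvlV (x ^+ n); have := xK n; move: (lvl (x ^+ n)) => s.
move: (lvl _) => t; lia.
Qed.

Definition cpos x : Prop := (0 <= lvl x)%R.

Lemma cposM x y : cpos x -> cpos y -> cpos (x * y).
Proof. by rewrite /cpos; have := lvlM x y; lia. Qed.

(** When [elt x] is not 1, the cocycle on [elt x] and its inverse equals 1, so the levels of [x] and
    [x^-1] add up to -1 and cannot both be nonnegative. *)
Lemma cpos_anti x : cpos x -> cpos x^-1 -> x = 1.
Proof.
rewrite /cpos => x0; have := lvlV x => bnd x0'.
have lx : lvl x = 0%R by lia.
have [e1|e1] := EM (elt x = 1); first exact: cext_ext.
by move: x0'; rewrite /= wrapV asboolT// lx.
Qed.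

Lemma cpos_total x : cpos x \/ cpos x^-1.
Proof. rewrite /cpos; have := lvlV x; lia. Qed.

(* The hypotheses are the defining relations of the Hantzsche-Wendt group. *)
Lemma promislow x y : x * y ^+ 2 * x^-1 = (y ^+ 2)^-1 ->
  y * x ^+ 2 * y^-1 = (x ^+ 2)^-1 -> x * y * x * y * (y * x * y * x) = 1.
Proof.
rewrite !expg2 => xy yx.
have E1 : x * (y * y) = (y * y)^-1 * x by rewrite -xy mulgVK.
have E2 : y^-1 * (x * x) * y = (x * x)^-1.
  have := congr1 (fun t => y^-1 * t^-1 * y) yx; rewrite /= invgK => <-.
  by rewrite !invgM !invgK !mulgA mulVg mul1g mulgVK.
have -> : x * y * x * y * (y * x * y * x) = x * y * (x * (y * y)) * (x * y * x).
  by rewrite !mulgA.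
rewrite E1 invgM.
have -> : x * y * (y^-1 * y^-1 * x) * (x * y * x) = x * (y^-1 * (x * x) * y) * x.
  by rewrite !mulgA mulgK.
by rewrite E2 invgM !mulgA mulgV mul1g mulVg.
Qed.

Lemma conjg_eqV_sym x w : x * w * x^-1 = w^-1 -> x^-1 * w * x = w^-1.
Proof.
move=> xw; have E : x * w = w^-1 * x by rewrite -xw mulgVK.
apply: (mulgI x); rewrite !mulgA mulgV mul1g; apply: (mulIg w).
by rewrite mulgVK -mulgA E mulVKg.
Qed.

Lemma conjg_eqV_inv x w : x * w * x^-1 = w^-1 -> x * w^-1 * x^-1 = w.
Proof.
by move=> /(congr1 (fun t => t^-1)); rewrite !invgM !invgK !mulgA.
Qed.

(** For positive [u] and [v] the identity of [promislow] writes [v^-1] as a product of positive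
    elements, whence [v = 1]. The two relations survive inverting either element, so positivity can
    be arranged. *)
Lemma promislow_trivial x y : x * y ^+ 2 * x^-1 = (y ^+ 2)^-1 ->
  y * x ^+ 2 * y^-1 = (x ^+ 2)^-1 -> y = 1.
Proof.
have main u v : cpos u -> cpos v -> u * v ^+ 2 * u^-1 = (v ^+ 2)^-1 ->
    v * u ^+ 2 * v^-1 = (u ^+ 2)^-1 -> v = 1.
  move=> u0 v0 uv vu; have E := promislow uv vu.
  apply: cpos_anti => //.
  have -> : v^-1 = u * v * v * u * v * u * u.
    apply: (mulgI v); rewrite mulgV; apply: (mulgI u); apply: (mulIg u^-1).
    by rewrite mulg1 mulgV -E !mulgA mulgK.
  by do !apply: cposM.
move=> xy yx; have [x0|x0] := cpos_total x; have [y0|y0] := cpos_total y.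
- exact: (main x y).
- suff : y^-1 = 1 by move=> /(congr1 (fun t => t^-1)); rewrite invgK invg1.
  apply: (main x y^-1) => //; rewrite ?expVgn ?invgK; first exact: conjg_eqV_inv.
  exact: conjg_eqV_sym.
- apply: (main x^-1 y) => //; rewrite ?expVgn ?invgK; first exact: conjg_eqV_sym.
  exact: conjg_eqV_inv.
- suff : y^-1 = 1 by move=> /(congr1 (fun t => t^-1)); rewrite invgK invg1.
  apply: (main x^-1 y^-1) => //; rewrite !expVgn !invgK.
    have := @conjg_eqV_inv x^-1 (y ^+ 2); rewrite invgK; apply.
    exact: conjg_eqV_sym.
  have := @conjg_eqV_inv y^-1 (x ^+ 2); rewrite invgK; apply.
  exact: conjg_eqV_sym.
Qed.

Lemma circ_group_trivial (c d e : gT) : cg_set C c -> cg_set C d -> cg_set C e ->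
  let b := c * d * c^-1 * d^-1 in let a := e * c * e^-1 * c^-1 in
  commute b d -> commute e (c * e * c^-1) ->
  a * b ^+ 2 * a^-1 = (b ^+ 2)^-1 -> b * a ^+ 2 * b^-1 = (a ^+ 2)^-1 -> b = 1.
Proof.
move=> Gc Gd Ge b a bd ece ab ba.
pose c' := Cext 0 Gc; pose d' := Cext 0 Gd; pose e' := Cext 0 Ge.
pose b' := c' * d' * c'^-1 * d'^-1; pose a' := e' * c' * e'^-1 * c'^-1.
have sb : slow b' by apply/slow_comm_of_commute/commute_lift.
(* [a'] is inverse to the commutator of [c'] and [e'], a product of the conjugate of [e'] by [c']
   with [e'^-1]; both factors commute with [e']. *)
have sa : slow a'.
  have -> : a' = (c' * e' * c'^-1 * e'^-1)^-1 by rewrite !invgM !invgK !mulgA.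
  apply/slowV/slow_comm_of_commute/commute_sym.
  have ee : commute e' (c' * e' * c'^-1) by apply: commute_lift.
  by apply: commuteM => //; apply: commuteV; apply: commute_refl.
suff -> : b = elt b' by rewrite (@promislow_trivial a' b')//;
  apply: conj_inv_lift => //; apply: slowX.
by [].
Qed.

End CentralExtension.

(** * The algebraic obstruction to circular orderability *)

Section NotCircularlyOrderable.
Local Open Scope group_scope.

(** The powers of [b] with exponents 0 to 3 are four distinct elements, so one of them avoids any
    three given points. *)
Lemma large_of_infinite_order (gT : groupType) (G : set gT) b :
  subgroup G -> torsion_free G -> G b -> b <> 1 ->
  forall x y z, exists2 q, G q & [/\ q <> x, q <> y & q <> z].
Proof.
move=> [G1 GM GV] tf Gb b1 x y z.
have GX n : G (b ^+ n) by elim: n => [//|n IH]; rewrite expgS; apply: GM.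
have neq i j : (i < j)%N -> b ^+ i <> b ^+ j.
  move=> ij bij; apply: b1; apply: (tf _ (j - i)%N Gb); first by rewrite subn_gt0.
  by rewrite expgnFr ?(ltnW ij)// bij mulgV.
have n01 := @neq 0%N 1%N isT; have n02 := @neq 0%N 2%N isT.
have n03 := @neq 0%N 3%N isT; have n12 := @neq 1%N 2%N isT.
have n13 := @neq 1%N 3%N isT; have n23 := @neq 2%N 3%N isT.
apply: contrapT => nex.
have in3 n : [\/ b ^+ n = x, b ^+ n = y | b ^+ n = z].
  apply: contrapT => nin; apply: nex; exists (b ^+ n); first exact: GX.
  by split=> e; apply: nin; [constructor 1|constructor 2|constructor 3].
by case: (in3 0%N) => e0; case: (in3 1%N) => e1; case: (in3 2%N) => e2;
  case: (in3 3%N) => e3; congruence.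
Qed.

Lemma not_circularly_orderable (gT : groupType) (G : set gT) (c d e : gT) :
  subgroup G -> torsion_free G -> G c -> G d -> G e ->
  let b := c * d * c^-1 * d^-1 in let a := e * c * e^-1 * c^-1 in
  commute b d -> commute e (c * e * c^-1) ->
  a * b ^+ 2 * a^-1 = (b ^+ 2)^-1 -> b * a ^+ 2 * b^-1 = (a ^+ 2)^-1 ->
  b <> 1 -> ~ circularly_orderable G.
Proof.
move=> sG tf Gc Gd Ge b a bd ece ab ba b1 [lt circ linv].
have Gb : G b.
  by case: sG => _ GM GV; exact: GM (GM _ _ (GM _ _ Gc Gd) (GV _ Gc)) (GV _ Gd).
have large := large_of_infinite_order sG tf Gb b1.
apply: b1; pose C := CircGroup sG circ linv large.
exact: (@circ_group_trivial _ C c d e).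
Qed.

End NotCircularlyOrderable.

(** * The abstract group of piecewise maps *)

Definition oddz (k : int) : bool := odd `|k|%N.

Lemma oddzD a b : oddz (a + b) = oddz a (+) oddz b.
Proof. rewrite /oddz; lia. Qed.

Lemma oddzN a : oddz (- a) = oddz a.
Proof. rewrite /oddz; lia. Qed.

Lemma oddzM a b : oddz (a * b) = oddz a && oddz b.
Proof. by rewrite /oddz abszM oddM. Qed.

Definition sgz_odd (k : int) : int := if oddz k then -1 else 1.

Lemma sgz_oddD a b : sgz_odd (a + b) = sgz_odd a * sgz_odd b.
Proof. by rewrite /sgz_odd oddzD; case: (oddz a); case: (oddz b). Qed.

Lemma sgz_oddN a : sgz_odd (- a) = sgz_odd a.
Proof. by rewrite /sgz_odd oddzN. Qed.

Lemma sgz_odd2 a : sgz_odd a * sgz_odd a = 1.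
Proof. by rewrite /sgz_odd; case: (oddz a). Qed.

Lemma oddz_sgz a k : oddz (a * sgz_odd k) = oddz a.
Proof. by rewrite oddzM /sgz_odd; case: (oddz k); rewrite andbT. Qed.

(* The fundamental group of the Klein bottle: [Klein n s] stands for p^n y^s,
   where p y p^-1 = y^-1. *)
Record klein := Klein { kshift : int; ktwist : int }.

HB.instance Definition _ := gen_eqMixin klein.
HB.instance Definition _ := gen_choiceMixin klein.

Definition klein_one := Klein 0 0.
Definition klein_mul g h :=
  Klein (kshift g + kshift h) (ktwist g * sgz_odd (kshift h) + ktwist h).
Definition klein_inv g := Klein (- kshift g) (- ktwist g * sgz_odd (kshift g)).

Lemma klein_ext g h : kshift g = kshift h -> ktwist g = ktwist h -> g = h.
Proof. by case: g h => [a b] [c d] /= -> ->. Qed.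

Lemma klein_mulA : associative klein_mul.
Proof.
move=> g h k; apply: klein_ext => /=; first by rewrite addrA.
rewrite sgz_oddD; ring.
Qed.

Lemma klein_mul1l : left_id klein_one klein_mul.
Proof. by move=> g; apply: klein_ext => /=; rewrite ?mul0r add0r. Qed.

Lemma klein_mul1r : right_id klein_one klein_mul.
Proof. by move=> g; apply: klein_ext => /=; rewrite ?mulr1 addr0. Qed.

Lemma klein_mulVl : left_inverse klein_one klein_inv klein_mul.
Proof.
move=> g; apply: klein_ext => /=; first by rewrite addNr.
by rewrite -mulrA sgz_odd2 mulr1 addNr.
Qed.

Lemma klein_mulVr : right_inverse klein_one klein_inv klein_mul.
Proof.
move=> g; apply: klein_ext => /=; first by rewrite subrr.
by rewrite sgz_oddN mulNr subrr.
Qed.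

HB.instance Definition _ := isGroup.Build klein
  klein_mulA klein_mul1l klein_mul1r klein_mulVl klein_mulVr.

Lemma klein_torsion_free (g : klein) n : (0 < n)%N -> (g ^+ n = 1)%g -> g = 1%g.
Proof.
move=> n0 gn1.
have shiftX m : kshift (g ^+ m)%g = kshift g * m%:Z.
  elim: m => [|m IH]; first by rewrite mulr0.
  rewrite expgS /= IH; lia.
have s0 : kshift g = 0.
  have := shiftX n; rewrite gn1 /= => /esym/eqP; rewrite mulf_eq0 => /orP[/eqP//|].
  lia.
have twistX m : ktwist (g ^+ m)%g = ktwist g * m%:Z.
  elim: m => [|m IH]; first by rewrite mulr0.
  rewrite expgS /= IH shiftX s0 mul0r mulr1; lia.
apply: klein_ext => //.
have := twistX n; rewrite gn1 /= => /esym/eqP; rewrite mulf_eq0 => /orP[/eqP//|].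
lia.
Qed.

(* [Pmap i j l F] acts on log-polar coordinates by scaling by e^i, the j-th
   power of the spiral twist, a half-turn if [l], and by the element [F k b] of
   the Klein bottle group on the lens centred at radius e^k on the positive
   ([b]) or negative ([~~ b]) half-axis; [F] is applied first. *)
Record pmap := Pmap {
  pscale : int; ptwist : int; pturn : bool; plens : int -> bool -> klein }.

HB.instance Definition _ := gen_eqMixin pmap.
HB.instance Definition _ := gen_choiceMixin pmap.

Lemma pmap_ext D E : pscale D = pscale E -> ptwist D = ptwist E ->
  pturn D = pturn E -> plens D =2 plens E -> D = E.
Proof.
case: D E => [i j l F] [i' j' l' F'] /= -> -> -> FF'.
by congr Pmap; apply/funext => k; apply/funext => b.
Qed.

(** Whether the twist and the half-turn together exchange the two lenses at radius e^k. *)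
Definition pswap D (k : int) : bool := oddz (ptwist D * k) (+) pturn D.

Lemma pswap_untwisted D k : ptwist D = 0 -> pswap D k = pturn D.
Proof. by rewrite /pswap => ->; rewrite mul0r. Qed.

Definition pmap_one := Pmap 0 0 false (fun _ _ => 1%g).
(** [E] acts first and carries the lens [(k, b)] to [(k + pscale E, b (+) pswap E k)], where the
    factor of [D] is read off. Scaling before twisting adds [ptwist D * pscale E] half-turns, of
    which only the parity counts. *)
Definition pmap_mul D E := Pmap (pscale D + pscale E) (ptwist D + ptwist E)
  (pturn D (+) pturn E (+) oddz (ptwist D * pscale E))
  (fun k b => (plens D (k + pscale E) (b (+) pswap E k) * plens E k b)%g).
Definition pmap_inv D := Pmap (- pscale D) (- ptwist D)
  (pturn D (+) oddz (ptwist D * pscale D))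
  (fun k b => (plens D (k - pscale D) (b (+) pswap D (k - pscale D)))^-1%g).

Lemma pswapM D E k : pswap (pmap_mul D E) k = pswap D (k + pscale E) (+) pswap E k.
Proof.
rewrite /pswap /= !oddzM oddzD !oddzD.
by case: (oddz (ptwist D)); case: (oddz (ptwist E)); case: (oddz k);
  case: (oddz (pscale E)); case: (pturn D); case: (pturn E).
Qed.

Lemma pmap_mulA : associative pmap_mul.
Proof.
move=> D E H; apply: pmap_ext => /=; rewrite ?addrA//.
  rewrite !oddzM !oddzD.
  by case: (oddz (ptwist D)); case: (oddz (ptwist E)); case: (oddz (pscale H));
    case: (oddz (pscale E)); case: (pturn D); case: (pturn E); case: (pturn H).
move=> k b /=; rewrite pswapM mulgA [pscale E + _]addrC !addrA.
by rewrite [_ (+) pswap H k]addbC addbA.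
Qed.

Lemma pmap_mul1l : left_id pmap_one pmap_mul.
Proof.
move=> D; apply: pmap_ext => /=; rewrite ?add0r ?mul0r ?addbF//.
by move=> k b; rewrite mul1g.
Qed.

Lemma pmap_mul1r : right_id pmap_one pmap_mul.
Proof.
move=> D; apply: pmap_ext => /=; rewrite ?addr0//.
  by rewrite mulr0 /oddz /= !addbF.
by move=> k b; rewrite /pswap mul0r /oddz /= addbF mulg1 addr0.
Qed.

Lemma pmap_mulVl : left_inverse pmap_one pmap_inv pmap_mul.
Proof.
move=> D; apply: pmap_ext => /=; rewrite ?addNr//.
  by rewrite mulNr oddzN; case: pturn; case: oddz.
by move=> k b; rewrite addrK -addbA addbb addbF mulVg.
Qed.

Lemma pmap_mulVr : right_inverse pmap_one pmap_inv pmap_mul.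
Proof.
move=> D; apply: pmap_ext => /=; rewrite ?subrr//.
  by rewrite mulrN oddzN; case: pturn; case: oddz.
move=> k b; rewrite -[RHS](mulgV (plens D (k - pscale D) (b (+) pswap D (k - pscale D)))).
congr (plens _ _ (_ (+) _) * _)%g.
rewrite /pswap /= !oddzM !oddzD !oddzN.
by case: (oddz (ptwist D)); case: (oddz k); case: (oddz (pscale D)); case: (pturn D).
Qed.

HB.instance Definition _ := isGroup.Build pmap
  pmap_mulA pmap_mul1l pmap_mul1r pmap_mulVl pmap_mulVr.

(* This parity condition rules out the half-turns that are involutions. *)
Definition pmap_balanced D := forall k,
  oddz (ktwist (plens D k true)) (+) oddz (ktwist (plens D k false)) = pswap D k.

Lemma oddz_ktwistM g h : oddz (ktwist (g * h)%g) = oddz (ktwist g) (+) oddz (ktwist h).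
Proof. by rewrite /= oddzD oddz_sgz. Qed.

Lemma oddz_ktwistV g : oddz (ktwist g^-1%g) = oddz (ktwist g).
Proof. by rewrite /= oddz_sgz oddzN. Qed.

Lemma pmap_balanced1 : pmap_balanced 1%g.
Proof. by move=> k; rewrite /pswap /= mul0r. Qed.

(** The parity of [ktwist] is a homomorphism, and its sum over two opposite lenses does not change
    when they are exchanged. *)
Lemma pmap_balancedM D E : pmap_balanced D -> pmap_balanced E ->
  pmap_balanced (D * E)%g.
Proof.
move=> bD bE k; rewrite [RHS]pswapM -bD -[in RHS]bE !oddz_ktwistM.
by rewrite addbACA; congr (_ (+) _); case: (pswap E k); rewrite // addbC.
Qed.

Lemma pmap_balancedV D : pmap_balanced D -> pmap_balanced D^-1%g.
Proof.
move=> bD k; rewrite !oddz_ktwistV.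
have -> : pswap D^-1%g k = pswap D (k - pscale D).
  rewrite /pswap /= !oddzM !oddzD !oddzN.
  by case: (oddz (ptwist D)); case: (oddz k); case: (oddz (pscale D)); case: (pturn D).
by rewrite -[RHS]bD; case: (pswap D _) => //=; rewrite addbC.
Qed.

(** Scale and twist are additive, hence zero. Without a half-turn the lenses do not interact and
    [klein_torsion_free] applies to each. With one, [D ^+ 2] is free of it and thus trivial, so the
    [ktwist] parities of two opposite lenses cancel, against balance. *)
Lemma pmap_torsion_free D n : pmap_balanced D -> (0 < n)%N -> (D ^+ n = 1)%g -> D = 1%g.
Proof.
move=> bD n0 Dn1.
have scaleX E m : pscale (E ^+ m)%g = pscale E * m%:Z.
  elim: m => [|m IH]; first by rewrite mulr0.
  rewrite expgS /= IH; lia.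
have twistX E m : ptwist (E ^+ m)%g = ptwist E * m%:Z.
  elim: m => [|m IH]; first by rewrite mulr0.
  rewrite expgS /= IH; lia.
have tf E : (E ^+ n = 1)%g -> pscale E = 0 /\ ptwist E = 0.
  move=> En1; split.
    have := scaleX E n; rewrite En1 /= => /esym/eqP; rewrite mulf_eq0 => /orP[/eqP//|].
    lia.
  have := twistX E n; rewrite En1 /= => /esym/eqP; rewrite mulf_eq0 => /orP[/eqP//|].
  lia.
have noturn E : pturn E = false -> (E ^+ n = 1)%g -> E = 1%g.
  move=> tE En1; have [sE wE] := tf _ En1.
  have lensX m k b : plens (E ^+ m)%g k b = (plens E k b ^+ m)%g.
    elim: m => [//|m IH]; rewrite !expgSr /= sE pswap_untwisted// tE addr0 addbF.
    by rewrite IH.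
  apply: pmap_ext => // k b; apply: (klein_torsion_free n0).
  by rewrite -lensX En1.
have [sD wD] := tf _ Dn1.
case tD : (pturn D); last exact: noturn.
have D21 : (D ^+ 2)%g = 1%g.
  apply: noturn; first by rewrite expg2 /= tD wD mul0r.
  by rewrite -expgnA mulnC expgnA Dn1 expg1n.
have := bD 0; rewrite pswap_untwisted// tD.
have : plens (D ^+ 2)%g 0 true = 1%g by rewrite D21.
rewrite expg2 /= sD pswap_untwisted// tD addr0 /= => H.
by rewrite addbC -oddz_ktwistM H.
Qed.

(** * The generators and their relations *)

Section Generators.
Local Open Scope group_scope.

Definition pmap_c := Pmap 1 0 false (fun _ _ => 1).
(** The twist exchanges opposite lenses exactly at odd [k]; one factor y there restores balance. *)
Definition pmap_d := Pmap 0 1 false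
  (fun k b => if oddz k && b then Klein 0 1 else 1).
Definition pmap_e := Pmap 0 0 false
  (fun k b => if oddz k then 1 else if b then Klein 1 0 else Klein (-1) 0).

Definition pmap_b := Pmap 0 0 true (fun k b =>
  if oddz k then (if b then 1 else Klein 0 (-1))
  else (if b then Klein 0 1 else 1)).
Definition pmap_a := Pmap 0 0 false
  (fun k b => if oddz k (+) b then Klein 1 0 else Klein (-1) 0).

Lemma pmap_bE : pmap_c * pmap_d * pmap_c^-1 * pmap_d^-1 = pmap_b.
Proof.
apply: pmap_ext => // k b /=; rewrite /pswap /= !(oddzD, oddzN, oddzM).
by case: (oddz k); case: b.
Qed.

Lemma pmap_aE : pmap_e * pmap_c * pmap_e^-1 * pmap_c^-1 = pmap_a.
Proof.
apply: pmap_ext => // k b /=; rewrite /pswap /= !(oddzD, oddzN, oddzM).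
by case: (oddz k); case: b.
Qed.

Lemma pmap_bd : commute pmap_b pmap_d.
Proof.
apply: pmap_ext => // k b /=; rewrite /pswap /= !(oddzD, oddzN, oddzM).
by case: (oddz k); case: b.
Qed.

(** [pmap_e] acts in the lenses with even [k]; its conjugate by [pmap_c] acts in those with odd
    [k]. *)
Lemma pmap_ece : commute pmap_e (pmap_c * pmap_e * pmap_c^-1).
Proof.
apply: pmap_ext => // k b /=; rewrite /pswap /= !(oddzD, oddzN, oddzM).
by case: (oddz k); case: b.
Qed.

(** In each lens [pmap_b ^+ 2] is y or its inverse and [pmap_a] is p or its inverse; both p and its
    inverse conjugate y to y^-1. *)
Lemma pmap_ab : pmap_a * pmap_b ^+ 2 * pmap_a^-1 = (pmap_b ^+ 2)^-1.
Proof.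
apply: pmap_ext => // k b /=; rewrite /pswap /= !(oddzD, oddzN, oddzM).
by case: (oddz k); case: b.
Qed.

(** [pmap_a ^+ 2] is p^2 in one lens of each opposite pair and p^-2 in the other. The half-turn in
    [pmap_b] exchanges them, and p^2 is central. *)
Lemma pmap_ba : pmap_b * pmap_a ^+ 2 * pmap_b^-1 = (pmap_a ^+ 2)^-1.
Proof.
apply: pmap_ext => // k b /=; rewrite /pswap /= !(oddzD, oddzN, oddzM).
by case: (oddz k); case: b.
Qed.

Lemma pmap_c_balanced : pmap_balanced pmap_c.
Proof. by move=> k; rewrite /pswap mul0r. Qed.

Lemma pmap_d_balanced : pmap_balanced pmap_d.
Proof. by move=> k; rewrite /pswap mul1r /=; case: (oddz k). Qed.

Lemma pmap_e_balanced : pmap_balanced pmap_e.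
Proof. by move=> k; rewrite /pswap mul0r /=; case: (oddz k). Qed.

End Generators.

(** * Homeomorphisms of the line and radial lens maps *)

Section LineHomeos.
Variable R : realType.
Implicit Types (s t u v w x y : R) (g h : klein).

Lemma increasing_continuous (f f' : R -> R) :
  {homo f : x y / x < y} -> cancel f' f -> continuous f.
Proof.
move=> fmono f'K x; apply/cvgrPdist_lt => e e0.
have le_of s t : f s < f t -> s < t.
  move=> st; case: (ltgtP s t) => // [/fmono ts|ts].
    by have := lt_trans st ts; rewrite ltxx.
  by move: st; rewrite ts ltxx.
have lo : f' (f x - e) < x by apply: le_of; rewrite f'K; lra.
have hi : x < f' (f x + e) by apply: le_of; rewrite f'K; lra.
near=> y.
have ylo : f' (f x - e) < y by near: y; exact: lt_nbhsr.
have yhi : y < f' (f x + e) by near: y; exact: lt_nbhsl.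
rewrite ltr_norml; have := fmono _ _ ylo; have := fmono _ _ yhi; rewrite !f'K; lra.
Unshelve. all: by end_near. Qed.

(** Multiplication of t / (1 - t) by e^s, written in the coordinate t: a flow on the unit interval
    with time [s], fixing both endpoints. *)
Definition mobius s t : R := t * expR s / (1 - t + t * expR s).

Lemma mobius_den s t : 0 <= t <= 1 -> 0 < 1 - t + t * expR s.
Proof. have := expR_gt0 s; nra. Qed.

Lemma mobius_itv s t : 0 <= t <= 1 -> 0 <= mobius s t <= 1.
Proof.
move=> t01; have d0 := mobius_den s t01; have := expR_gt0 s => e0.
rewrite /mobius ler_pdivlMr// ler_pdivrMr//; nra.
Qed.

Lemma mobius_lt1 s t : 0 <= t < 1 -> mobius s t < 1.
Proof.
move=> t01; have d0 : 0 < 1 - t + t * expR s by apply: mobius_den; lra.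
rewrite /mobius ltr_pdivrMr//; nra.
Qed.

Lemma mobius_mono s t u : 0 <= t <= 1 -> 0 <= u <= 1 -> t < u ->
  mobius s t < mobius s u.
Proof.
move=> t01 u01 tu; have d0 := mobius_den s t01; have d1 := mobius_den s u01.
rewrite /mobius ltr_pdivrMr// mulrAC ltr_pdivlMr//.
have := expR_gt0 s; nra.
Qed.

Lemma mobiusD s t u : 0 <= u <= 1 -> mobius s (mobius t u) = mobius (s + t) u.
Proof.
move=> u01; have d0 := mobius_den t u01; have d1 := mobius_den (s + t) u01.
rewrite /mobius; move: d0 d1; rewrite expRD => d0 d1.
field.
by rewrite !lt0r_neq0.
Qed.

Lemma mobius0 u : 0 <= u <= 1 -> mobius 0 u = u.
Proof. by move=> u01; rewrite /mobius expR0 mulr1 subrK divr1. Qed.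

Lemma floorP x : (Num.floor x)%:~R <= x < (Num.floor x)%:~R + 1.
Proof. by have := floor_itv x; rewrite intrD. Qed.

Lemma floor_frac x : 0 <= x - (Num.floor x)%:~R < 1.
Proof. by have := floorP x; lra. Qed.

(* [p] is the unit translation and [y] a flow fixing the integers, whose
   direction alternates from one unit interval to the next. *)
Definition klein_line g x : R :=
  (kshift g + Num.floor x)%:~R +
  mobius (ktwist g * sgz_odd (Num.floor x))%:~R (x - (Num.floor x)%:~R).

Lemma klein_line_floor g x :
  Num.floor (klein_line g x) = kshift g + Num.floor x.
Proof.
have f01 := floor_frac x.
apply: floor_def; rewrite /klein_line.
have := @mobius_itv (ktwist g * sgz_odd (Num.floor x))%:~R (x - (Num.floor x)%:~R).
have := @mobius_lt1 (ktwist g * sgz_odd (Num.floor x))%:~R (x - (Num.floor x)%:~R).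
move: (mobius _ _) => m m1 m01; have := m1 f01; have : 0 <= m <= 1 by apply: m01; lra.
rewrite !intrD; lra.
Qed.

Lemma klein_lineM g h x : klein_line (g * h)%g x = klein_line g (klein_line h x).
Proof.
have f01 := floor_frac x; rewrite [in RHS]/klein_line klein_line_floor.
set m := Num.floor x in f01 *; rewrite /klein_line -/m.
have -> : (kshift h + m)%:~R + mobius (ktwist h * sgz_odd m)%:~R (x - m%:~R) -
    (kshift h + m)%:~R = mobius (ktwist h * sgz_odd m)%:~R (x - m%:~R) by rewrite addrC addKr.
rewrite mobiusD; last by lra.
congr (_ + mobius _ _); first by rewrite /= addrA.
rewrite -intrD; congr intmul; rewrite /= sgz_oddD; ring.
Qed.

Lemma klein_line1 x : klein_line 1%g x = x.
Proof.
have f01 := floor_frac x.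
rewrite /klein_line /= mul0r mobius0 ?add0r; first by rewrite addrC subrK.
lra.
Qed.

Lemma klein_line_mono g : {homo klein_line g : x y / x < y}.
Proof.
move=> x y xy; have fx := floor_frac x; have fy := floor_frac y.
have xfy := ltW xy; have := le_floor xfy; rewrite le_eqVlt => /orP[/eqP xeqy|xlty].
  by rewrite /klein_line xeqy ltrD2l; apply: mobius_mono; move: xeqy fx fy => <-; lra.
have : (Num.floor x + 1)%:~R <= (Num.floor y)%:~R :> R by rewrite ler_int; lia.
rewrite /klein_line !intrD.
have := @mobius_lt1 (ktwist g * sgz_odd (Num.floor x))%:~R _ fx.
have : 0 <= y - (Num.floor y)%:~R <= 1 by lra.
move/(@mobius_itv (ktwist g * sgz_odd (Num.floor y))%:~R).
by move: (mobius _ _) (mobius _ _) => a b; lra.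
Qed.

(** The floor of the image of 0 gives the shift, and the image of 1/2 gives the time of the flow. *)
Lemma klein_line_faithful g : klein_line g =1 id -> g = 1%g.
Proof.
move=> gid; have g0 := klein_line_floor g 0; rewrite gid floor0 addr0 in g0.
apply: klein_ext => //=.
have f2 : Num.floor (2^-1 : R) = 0 by apply: floor_def; rewrite add0r; lra.
have := gid 2^-1; rewrite /klein_line f2 -g0 addr0 !mulr0z add0r subr0.
rewrite /sgz_odd /= mulr1 /mobius.
have e0 := expR_gt0 ((ktwist g)%:~R : R).
move=> /(congr1 (fun t => t * (1 - 2^-1 + 2^-1 * expR (ktwist g)%:~R))).
rewrite mulfVK; last by rewrite gt_eqF//; lra.
move=> E; have : expR ((ktwist g)%:~R : R) = expR 0 by rewrite expR0; lra.
by move=> /expR_inj /eqP; rewrite intr_eq0 => /eqP.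
Qed.

Definition squash x : R := x / (1 + `|x|).
Definition unsquash w : R := w / (1 - `|w|).

Lemma squash_lt1 x : `|squash x| < 1.
Proof.
have n0 := normr_ge0 x; rewrite /squash normrM normfV [`|1 + _|]ger0_norm; last by lra.
by rewrite ltr_pdivrMr; lra.
Qed.

Lemma squashK : cancel squash unsquash.
Proof.
move=> x; have n0 := normr_ge0 x; rewrite /unsquash /squash normrM normfV.
rewrite [`|1 + _|]ger0_norm; last by lra.
field; apply/andP; split; rewrite gt_eqF//; lra.
Qed.

Lemma unsquashK w : `|w| < 1 -> squash (unsquash w) = w.
Proof.
move=> w1; have n0 := normr_ge0 w; rewrite /unsquash /squash normrM normfV.
rewrite [`|1 - _|]gtr0_norm; last by lra.
field; apply/andP; split; rewrite gt_eqF//; lra.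
Qed.

Lemma squash_mono : {homo squash : x y / x < y}.
Proof.
move=> x y xy; have x0 : 0 < 1 + `|x| by have := normr_ge0 x; lra.
have y0 : 0 < 1 + `|y| by have := normr_ge0 y; lra.
rewrite /squash ltr_pdivrMr// mulrAC ltr_pdivlMr//.
by case: (ger0P x); case: (ger0P y); nra.
Qed.

Lemma unsquash_mono v w : `|v| < 1 -> `|w| < 1 -> v < w -> unsquash v < unsquash w.
Proof.
move=> v1 w1 vw; rewrite ltNge; apply/negP; rewrite le_eqVlt => /orP[/eqP E|/squash_mono].
  by move: vw; rewrite -(unsquashK v1) -E unsquashK// ltxx.
by rewrite !unsquashK//; lra.
Qed.

Definition klein_itv g w : R :=
  if `|w| < 1 then squash (klein_line g (unsquash w)) else w.

Lemma klein_itv_out g w : 1 <= `|w| -> klein_itv g w = w.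
Proof. by rewrite /klein_itv ltNge => ->. Qed.

Lemma klein_itv_in g w : `|w| < 1 -> `|klein_itv g w| < 1.
Proof. by rewrite /klein_itv => ->; exact: squash_lt1. Qed.

Lemma klein_itvM g h w : klein_itv (g * h)%g w = klein_itv g (klein_itv h w).
Proof.
rewrite [in RHS]/klein_itv; case: ifPn => [kw|]; last first.
  rewrite /klein_itv; case: ifPn => // w1.
  by rewrite squash_lt1.
have w1 : `|w| < 1.
  by move: kw; rewrite /klein_itv; case: ifPn => // /negbTE ->.
by rewrite /klein_itv w1 squashK klein_lineM.
Qed.

Lemma klein_itv1 w : klein_itv 1%g w = w.
Proof. by rewrite /klein_itv klein_line1; case: ifPn => // w1; rewrite unsquashK. Qed.

Lemma klein_itv_mono g : {homo klein_itv g : v w / v < w}.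
Proof.
move=> v w vw; have [v1|v1] := ltP `|v| 1; have [w1|w1] := ltP `|w| 1.
- rewrite /klein_itv v1 w1; apply: squash_mono; apply: klein_line_mono.
  exact: unsquash_mono.
- have := klein_itv_in g v1; rewrite (klein_itv_out _ w1) !ltr_norml.
  move: v1 w1; rewrite ltr_norml; case: (ger0P w); lra.
- have := klein_itv_in g w1; rewrite (klein_itv_out _ v1) !ltr_norml.
  move: v1 w1; rewrite ltr_norml; case: (ger0P v); lra.
- by rewrite !klein_itv_out.
Qed.

Lemma klein_itv_continuous g : continuous (klein_itv g).
Proof.
apply: (@increasing_continuous _ (klein_itv g^-1%g)); first exact: klein_itv_mono.
by move=> w; rewrite -klein_itvM mulgV klein_itv1.
Qed.

Lemma klein_itv_dist g w : `|klein_itv g w - w| <= 2.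
Proof.
have [w1|w1] := ltP `|w| 1; last by rewrite klein_itv_out// subrr normr0.
have := klein_itv_in g w1; move: w1; rewrite !ltr_norml ler_norml; lra.
Qed.

Lemma klein_itv_faithful g : klein_itv g =1 id -> g = 1%g.
Proof.
move=> gid; apply: klein_line_faithful => x.
have := gid (squash x); rewrite /klein_itv squash_lt1 squashK.
by move=> /(congr1 unsquash); rewrite !squashK.
Qed.

End LineHomeos.

(** * The plateau function and the radial action on lenses *)

Section Lenses.
Variable R : realType.
Implicit Types (u v w x y : R) (F G : int -> bool -> klein) (k i : int).

Definition round u : int := Num.floor (u + 2^-1).

Lemma roundP u : (round u)%:~R - 2^-1 <= u < (round u)%:~R + 2^-1.
Proof. have := floorP (u + 2^-1); rewrite -/(round u); lra. Qed.

Lemma round_uniq u k : k%:~R - 2^-1 <= u < k%:~R + 2^-1 -> round u = k.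
Proof. by move=> uk; apply: floor_def; rewrite intrD; lra. Qed.

Lemma roundD u i : round (u + i%:~R) = round u + i.
Proof. by apply: round_uniq; rewrite intrD; have := roundP u; lra. Qed.

(* [plateau] is constant near each integer, so that the spiral twist
   [spin_map] is an integral power of the half-turn on every lens. *)
Definition plateau u : R := (round u)%:~R +
  2 * Num.max 0 (u - (round u)%:~R - 4^-1) - 2 * Num.max 0 ((round u)%:~R - u - 4^-1).

Lemma plateauD u i : plateau (u + i%:~R) = plateau u + i%:~R.
Proof.
rewrite /plateau roundD intrD.
have -> : u + i%:~R - ((round u)%:~R + i%:~R) = u - (round u)%:~R by lra.
have -> : (round u)%:~R + i%:~R - (u + i%:~R) = (round u)%:~R - u by lra.
lra.
Qed.

Lemma plateau_near u k : `|u - k%:~R| <= 4^-1 -> plateau u = k%:~R.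
Proof.
rewrite ler_norml => uk; rewrite /plateau (@round_uniq u k); last lra.
by rewrite !max_l; lra.
Qed.

Lemma plateau_lip u v : v <= u -> 0 <= plateau u - plateau v <= 2 * (u - v).
Proof.
have max0 (t : R) : [/\ t <= 0 & Num.max 0 t = 0] \/ [/\ 0 <= t & Num.max 0 t = t].
  by case: (leP 0 t) => t0; [right|left]; split; rewrite ?max_r ?max_l ?(ltW t0).
move=> vu; rewrite /plateau; have ru := roundP u; have rv := roundP v.
have uv2 : v + 2^-1 <= u + 2^-1 by lra.
have := le_floor uv2; rewrite -/(round u) -/(round v) le_eqVlt => /orP[/eqP E|lt].
  rewrite E; case: (max0 (u - (round u)%:~R - 4^-1)) => -[? ->];
    case: (max0 ((round u)%:~R - u - 4^-1)) => -[? ->];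
    case: (max0 (v - (round u)%:~R - 4^-1)) => -[? ->];
    case: (max0 ((round u)%:~R - v - 4^-1)) => -[? ->]; lra.
have : (round v + 1)%:~R <= (round u)%:~R :> R by rewrite ler_int; lia.
rewrite intrD => lt'.
case: (max0 (u - (round u)%:~R - 4^-1)) => -[? ->];
  case: (max0 ((round u)%:~R - u - 4^-1)) => -[? ->];
  case: (max0 (v - (round v)%:~R - 4^-1)) => -[? ->];
  case: (max0 ((round v)%:~R - v - 4^-1)) => -[? ->]; lra.
Qed.

Lemma plateau_continuous : continuous plateau.
Proof.
move=> u; apply/cvgrPdist_lt => e e0; near=> v.
have ulo : u - e / 2 < v by near: v; apply: lt_nbhsr; lra.
have uhi : v < u + e / 2 by near: v; apply: lt_nbhsl; lra.
rewrite ltr_norml; case: (leP u v) => uv; first by have := plateau_lip uv; lra.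
have := plateau_lip (ltW uv); lra.
Unshelve. all: by end_near. Qed.

(** Between 1/4 and 3/4 [plateau] climbs from 0 to 1, so the slope bound 2, applied from both ends,
    is attained throughout. *)
Lemma plateau_slope u : 4^-1 <= u <= 3 / 4 -> plateau u = 2 * u - 2^-1.
Proof.
move=> u13; have p0 : plateau 4^-1 = 0%:~R by apply: plateau_near; rewrite ler_norml; lra.
have p1 : plateau (3 / 4) = 1%:~R by apply: plateau_near; rewrite ler_norml; lra.
have := @plateau_lip u 4^-1; have := @plateau_lip (3 / 4) u.
rewrite p0 p1 mulr0z mulr1z; lra.
Qed.

(** [u] is the logarithm of the radius and [x] the cosine of the polar angle, whose sign selects the
    half-axis. The lens at [k] is the region where |u - k| < |x| / 4, so it pinches to a point at
    the vertical axis; written as a displacement, the map is the identity at [x = 0]. *)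
Definition lens F u x : R :=
  let k := round u in let w := (u - k%:~R) / (`|x| / 4) in
  u + `|x| / 4 * (klein_itv (F k (0 < x)) w - w).

Lemma lens_dist F u x : `|lens F u x - u| <= `|x| / 2.
Proof.
rewrite /lens /= [_ + _ - u]addrC addKr normrM.
have := klein_itv_dist (F (round u) (0 < x)) ((u - (round u)%:~R) / (`|x| / 4)).
have x0 := normr_ge0 x; rewrite [`|_ / 4|]ger0_norm; last by lra.
move: (`|klein_itv _ _ - _|) => a; nra.
Qed.

Lemma lens0 F u : lens F u 0 = u.
Proof. by rewrite /lens normr0 mul0r mul0r addr0. Qed.

Lemma lens1 u x : lens (fun _ _ => 1%g) u x = u.
Proof. by rewrite /lens klein_itv1 subrr mulr0 addr0. Qed.

Lemma lens_out F u x : `|x| <= 4 * `|u - (round u)%:~R| -> lens F u x = u.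
Proof.
have [->|x0] := eqVneq x 0; first by rewrite lens0.
move=> xu; rewrite /lens klein_itv_out ?subrr ?mulr0 ?addr0//.
have x0' : 0 < `|x| by rewrite normr_gt0.
rewrite normrM normfV [`|_ / 4|]ger0_norm; last by lra.
by rewrite ler_pdivlMr; lra.
Qed.

Lemma lens_in F u x : `|x| <= 1 -> 4 * `|u - (round u)%:~R| < `|x| ->
  [/\ `|lens F u x - (round u)%:~R| < `|x| / 4, round (lens F u x) = round u &
    lens F u x = (round u)%:~R +
     `|x| / 4 * klein_itv (F (round u) (0 < x)) ((u - (round u)%:~R) / (`|x| / 4))].
Proof.
move=> x1 ux; have x0 : 0 < `|x| by have := normr_ge0 (u - (round u)%:~R); lra.
have E : lens F u x = (round u)%:~R + `|x| / 4 *
    klein_itv (F (round u) (0 < x)) ((u - (round u)%:~R) / (`|x| / 4)).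
  by rewrite /lens mulrBr [_ * (_ / _)]mulrC divfK ?gt_eqF//; lra.
have D : `|lens F u x - (round u)%:~R| < `|x| / 4.
  rewrite E [_ + _ - _]addrC addKr normrM ger0_norm; last by lra.
  rewrite gtr_pMr; last by lra.
  apply: klein_itv_in; rewrite normrM normfV [`|_ / 4|]ger0_norm; last by lra.
  by rewrite ltr_pdivrMr; lra.
split=> //; apply: round_uniq; move: D; rewrite ltr_norml; lra.
Qed.

Lemma lensP F u x : `|x| <= 1 ->
  (4 * `|u - (round u)%:~R| < `|x|) \/ lens F u x = u.
Proof.
by move=> x1; have [|?] := ltP (4 * `|u - (round u)%:~R|) `|x|; [left|right; exact: lens_out].
Qed.

Lemma lensM F G u x : `|x| <= 1 ->
  lens F (lens G u x) x = lens (fun k b => F k b * G k b)%g u x.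
Proof.
move=> x1; have [ux|xu] := ltP (4 * `|u - (round u)%:~R|) `|x|; last first.
  by rewrite !lens_out// (lens_out G xu).
have [D r E] := lens_in G x1 ux.
have ux' : 4 * `|lens G u x - (round (lens G u x))%:~R| < `|x| by rewrite r; lra.
have [_ _ ->] := lens_in F x1 ux'; have [_ _ ->] := lens_in (fun k b => F k b * G k b)%g x1 ux.
have x0 : 0 < `|x| by have := normr_ge0 (u - (round u)%:~R); lra.
rewrite r klein_itvM; congr (_ + _ * klein_itv _ _).
by rewrite E [X in X / _]addrC addKr mulrC mulKf// gt_eqF//; lra.
Qed.

Lemma plateau_lens F u x : `|x| <= 1 -> plateau (lens F u x) = plateau u.
Proof.
move=> x1; case: (lensP F u x1) => [ux|->//].
have [D _ _] := lens_in F x1 ux.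
by rewrite !(@plateau_near _ (round u))//; lra.
Qed.

Lemma lensD F u x i : lens F (u + i%:~R) x = lens (fun k => F (k + i)) u x + i%:~R.
Proof.
rewrite /lens roundD intrD.
have -> : u + i%:~R - ((round u)%:~R + i%:~R) = u - (round u)%:~R by lra.
lra.
Qed.

(** Every cell of half-width 1/2 around an integer is mapped into itself, which settles points of
    different cells; within a cell the map is a rescaled [klein_itv]. *)
Lemma lens_mono F u v x : `|x| <= 1 -> u < v -> lens F u x < lens F v x.
Proof.
move=> x1 uv.
have cell w : (round w)%:~R - 2^-1 <= lens F w x < (round w)%:~R + 2^-1.
  case: (lensP F w x1) => [wx|->]; last exact: roundP.
  by have [+ _ _] := lens_in F x1 wx; rewrite ltr_norml; lra.
have uv2 : u + 2^-1 <= v + 2^-1 by lra.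
have := le_floor uv2; rewrite -/(round u) -/(round v) le_eqVlt => /orP[/eqP E|lt]; last first.
  have : (round u + 1)%:~R <= (round v)%:~R :> R by rewrite ler_int; lia.
  rewrite intrD; have := cell u; have := cell v; lra.
have [->|x0] := eqVneq x 0; first by rewrite !lens0.
have x0' : 0 < `|x| by rewrite normr_gt0.
have F' w : lens F w x = (round w)%:~R + `|x| / 4 *
    klein_itv (F (round w) (0 < x)) ((w - (round w)%:~R) / (`|x| / 4)).
  by rewrite /lens mulrBr [_ * (_ / _)]mulrC divfK ?gt_eqF//; lra.
rewrite !F' E ltrD2l ltr_pM2l; last by lra.
by apply: klein_itv_mono; rewrite ltr_pM2r ?invr_gt0; lra.
Qed.

(** Farther than 1/4 from the integers both sides equal [u]. A twist therefore has to be compared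
    with the lenses only where [plateau] is constant. *)
Lemma eq_lens F G u x y : `|x| <= 1 -> `|y| <= 1 ->
  (`|u - (round u)%:~R| <= 4^-1 -> `|x| = `|y| /\
    (x != 0 -> F (round u) (0 < x) = G (round u) (0 < y))) ->
  lens F u x = lens G u y.
Proof.
move=> x1 y1 H; have [uk|uk] := leP `|u - (round u)%:~R| 4^-1; last first.
  by rewrite !lens_out//; lra.
have [xy FG] := H uk; have [x0|x0] := eqVneq x 0; last by rewrite /lens -xy -FG.
by move: xy; rewrite x0 normr0 => /esym/eqP; rewrite normr_eq0 => /eqP ->; rewrite !lens0.
Qed.

End Lenses.

(** * Maps of the plane in polar coordinates *)

Section PolarCoordinates.
Variable R : realType.
Local Notation plane := (R * R)%type.
Implicit Types (z p q : plane) (u v a b s : R) (F G : int -> bool -> klein).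

Lemma continuous_pair (T : topologicalType) (f g : T -> R) (x : T) :
  {for x, continuous f} -> {for x, continuous g} ->
  {for x, continuous (fun t => (f t, g t) : plane)}.
Proof. by move=> fx gx; exact: (cvg_pair fx gx). Qed.

Lemma continuous_fst z : {for z, continuous (fun w : plane => w.1)}.
Proof. exact: cvg_fst. Qed.

Lemma continuous_snd z : {for z, continuous (fun w : plane => w.2)}.
Proof. exact: cvg_snd. Qed.

Definition rho z : R := Num.sqrt (z.1 ^+ 2 + z.2 ^+ 2).

Definition cmul a b z : plane := (a * z.1 - b * z.2, b * z.1 + a * z.2).

(** The complex exponential of u + i a; [cmul] is complex multiplication by a + i b. *)
Definition pol u a : plane := (expR u * cos a, expR u * sin a).

Definition logr z : R := ln (rho z).
Definition dirx z : R := z.1 / rho z.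

Lemma rho_ge0 z : 0 <= rho z. Proof. exact: sqrtr_ge0. Qed.

Lemma rho_sqr z : rho z ^+ 2 = z.1 ^+ 2 + z.2 ^+ 2.
Proof. by rewrite sqr_sqrtr// addr_ge0 ?sqr_ge0. Qed.

Lemma rho_eq0 z : (rho z == 0) = (z == 0).
Proof.
apply/eqP/eqP => [r0|->]; last by rewrite /rho expr0n addr0 sqrtr0.
have := rho_sqr z; rewrite r0 expr0n /= => /esym/eqP.
rewrite paddr_eq0 ?sqr_ge0// !sqrf_eq0 => /andP[/eqP z1 /eqP z2].
by case: z z1 z2 {r0} => x y /= -> ->.
Qed.

Lemma rho_gt0 z : (0 < rho z) = (z != 0).
Proof. by rewrite lt0r rho_eq0 rho_ge0 andbT. Qed.

Lemma rho_cmul a b z : rho (cmul a b z) = Num.sqrt (a ^+ 2 + b ^+ 2) * rho z.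
Proof.
rewrite /rho -sqrtrM ?addr_ge0 ?sqr_ge0//; congr Num.sqrt => /=; ring.
Qed.

Lemma rho_rot b z : rho (cmul (cos b) (sin b) z) = rho z.
Proof. by rewrite rho_cmul cos2Dsin2 sqrtr1 mul1r. Qed.

Lemma rho_pol u a : rho (pol u a) = expR u.
Proof.
by rewrite /rho /= !exprMn -mulrDr cos2Dsin2 mulr1 sqrtr_sqr ger0_norm ?expR_ge0.
Qed.

Lemma logr_pol u a : logr (pol u a) = u.
Proof. by rewrite /logr rho_pol expRK. Qed.

Lemma dirx_pol u a : dirx (pol u a) = cos a.
Proof. by rewrite /dirx rho_pol /= mulrC mulKf// gt_eqF ?expR_gt0. Qed.

Lemma pol_neq0 u a : pol u a != 0.
Proof. by rewrite -rho_gt0 rho_pol expR_gt0. Qed.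

Lemma cmul_pol v b u a :
  cmul (expR v * cos b) (expR v * sin b) (pol u a) = pol (u + v) (a + b).
Proof. by rewrite /cmul /pol /= expRD cosD sinD; congr pair; ring. Qed.

Lemma cos_sin_surj x y : x ^+ 2 + y ^+ 2 = 1 -> exists a : R, x = cos a /\ y = sin a.
Proof.
move=> xy1; have x1 : -1 <= x <= 1.
  have := sqr_ge0 y; have := xy1; nra.
have [y0|y0] := leP 0 y.
  exists (acos x); rewrite acosK ?in_itv//= sin_acos//; split=> //.
  have -> : 1 - x ^+ 2 = y ^+ 2 by rewrite -xy1; ring.
  by rewrite sqrtr_sqr ger0_norm.
exists (- acos x); rewrite cosN sinN acosK ?in_itv//= sin_acos//; split=> //.
have -> : 1 - x ^+ 2 = y ^+ 2 by rewrite -xy1; ring.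
by rewrite sqrtr_sqr ltr0_norm// opprK.
Qed.

Lemma pol_surj z : z != 0 -> exists u a, z = pol u a.
Proof.
rewrite -rho_gt0 => r0.
have [a [ca sa]] : exists a, z.1 / rho z = cos a /\ z.2 / rho z = sin a.
  apply: cos_sin_surj; rewrite !exprMn -mulrDl -rho_sqr exprVn divff//.
  by rewrite expf_neq0// gt_eqF.
exists (logr z), a; rewrite /pol /logr lnK ?posrE// -ca -sa.
by rewrite mulrC divfK ?gt_eqF// mulrC divfK ?gt_eqF// -surjective_pairing.
Qed.

Lemma plane_ext (f g : plane -> plane) : f 0 = g 0 ->
  (forall u a, f (pol u a) = g (pol u a)) -> f =1 g.
Proof.
move=> f0 fp z; have [->//|/pol_surj[u [a ->]]] := eqVneq z 0; exact: fp.
Qed.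

Lemma dirx_le1 z : `|dirx z| <= 1.
Proof.
have [->|z0] := eqVneq z 0; first by rewrite /dirx mul0r normr0.
by have [u [a ->]] := pol_surj z0; rewrite dirx_pol ler_norml cos_geN1 cos_le1.
Qed.

Lemma rho_continuous : continuous rho.
Proof.
move=> z; apply: continuous_comp; last exact: sqrt_continuous.
have fc := @continuous_fst z; have sc := @continuous_snd z.
exact: (continuousD (continuousM fc fc) (continuousM sc sc)).
Qed.

Lemma logr_continuous z : z != 0 -> {for z, continuous logr}.
Proof.
move=> z0; apply: continuous_comp; first exact: rho_continuous.
by apply: continuous_ln; rewrite rho_gt0.
Qed.

Lemma dirx_continuous z : z != 0 -> {for z, continuous dirx}.
Proof.
move=> z0; apply: cvgM; first exact: cvg_fst.
apply: cvgV; first by rewrite rho_eq0.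
exact: rho_continuous.
Qed.

(* At the origin boundedness of the coefficients is enough. *)
Lemma cmul_continuous (A B : plane -> R) (K : R) :
  (forall z, z != 0 -> {for z, continuous A}) ->
  (forall z, z != 0 -> {for z, continuous B}) ->
  (forall z, `|A z| <= K) -> (forall z, `|B z| <= K) ->
  continuous (fun z => cmul (A z) (B z) z).
Proof.
move=> Ac Bc AK BK z; have [->|z0] := eqVneq z 0; last first.
  have fc := @continuous_fst z; have sc := @continuous_snd z.
  have Az := Ac _ z0; have Bz := Bc _ z0.
  apply: (@continuous_pair _ (fun w => A w * w.1 - B w * w.2)
    (fun w => B w * w.1 + A w * w.2)).
    exact: (continuousB (continuousM Az fc) (continuousM Bz sc)).
  exact: (continuousD (continuousM Bz fc) (continuousM Az sc)).
have cvg0 (C D : plane -> R) (f g : plane -> R) :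
    (forall z, `|C z| <= K) -> (forall z, `|D z| <= K) ->
    f z @[z --> (0 : plane)] --> 0 -> g z @[z --> (0 : plane)] --> 0 ->
    C z * f z + D z * g z @[z --> (0 : plane)] --> (0 : R).
  move=> CK DK f0 g0; apply/cvgr0Pnorm_lt => e e0.
  have K0 : 0 <= K by apply: le_trans (CK 0).
  have e'0 : 0 < e / (2 * (K + 1)) by rewrite divr_gt0//; lra.
  have /cvgr0Pnorm_lt/(_ _ e'0) fe := f0; have /cvgr0Pnorm_lt/(_ _ e'0) ge := g0.
  near=> w.
  have fw : `|f w| < e / (2 * (K + 1)) by near: w.
  have gw : `|g w| < e / (2 * (K + 1)) by near: w.
  apply: le_lt_trans (ler_normD _ _) _; rewrite !normrM.
  move: fw gw; rewrite !ltr_pdivlMr; try lra.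
  have := CK w; have := DK w; have := normr_ge0 (f w); have := normr_ge0 (g w).
  move: `|C w| `|D w| `|f w| `|g w| => c d x y y0 x0 dK cK xe ye; nra.
have -> : (fun z => cmul (A z) (B z) z) =
    (fun z => (A z * z.1 + B z * (- z.2), B z * z.1 + A z * z.2)).
  by apply/funext => w; rewrite /cmul mulrN.
have fst0 : w.1 @[w --> (0 : plane)] --> (0 : R) by exact: cvg_fst.
have snd0 : w.2 @[w --> (0 : plane)] --> (0 : R) by exact: cvg_snd.
have sndN0 : - w.2 @[w --> (0 : plane)] --> (0 : R).
  by rewrite -[X in _ --> X]oppr0; apply: cvgN.
apply: (@continuous_pair _ (fun w => A w * w.1 + B w * - w.2)
  (fun w => B w * w.1 + A w * w.2)); rewrite /prop_for /continuous_at /=.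
  by rewrite oppr0 !mulr0 addr0; apply: cvg0.
by rewrite !mulr0 addr0; apply: cvg0.
Unshelve. all: by end_near. Qed.

End PolarCoordinates.

(** * Scaling, spiral twist and lens maps of the plane *)

Section PlaneMaps.
Variable R : realType.
Local Notation plane := (R * R)%type.
Implicit Types (z p q : plane) (u v a b s : R) (F G : int -> bool -> klein).

Definition scale_map v z : plane := cmul (expR v) 0 z.
Definition spin_map s z : plane :=
  cmul (cos (s * (pi * plateau (logr z)))) (sin (s * (pi * plateau (logr z)))) z.
Definition lens_map F z : plane :=
  cmul (expR (lens F (logr z) (dirx z) - logr z)) 0 z.

Lemma cmul0 a b : cmul a b (0 : plane) = 0.
Proof. by rewrite /cmul /= !mulr0 subr0 addr0. Qed.

Lemma scale_map_pol v u a : scale_map v (pol u a) = pol (u + v) a.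
Proof.
by have := cmul_pol v 0 u a; rewrite cos0 sin0 mulr1 mulr0 addr0.
Qed.

Lemma spin_map_pol s u a : spin_map s (pol u a) = pol u (a + s * (pi * plateau u)).
Proof.
rewrite /spin_map logr_pol; have := cmul_pol 0 (s * (pi * plateau u)) u a.
by rewrite expR0 !mul1r addr0.
Qed.

Lemma lens_map_pol F u a : lens_map F (pol u a) = pol (lens F u (cos a)) a.
Proof.
rewrite /lens_map logr_pol dirx_pol; have := cmul_pol (lens F u (cos a) - u) 0 u a.
rewrite cos0 sin0 mulr1 mulr0 addr0 => ->; congr pol; lra.
Qed.

Lemma scale_map_continuous v : continuous (scale_map v).
Proof.
apply: (@cmul_continuous _ (fun=> expR v) (fun=> 0) (expR v)) => z *; try exact: cvg_cst.
  by rewrite ger0_norm ?expR_ge0.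
by rewrite normr0 expR_ge0.
Qed.

Lemma norm_cos_le1 a : `|cos a| <= 1.
Proof. by rewrite ler_norml cos_geN1 cos_le1. Qed.

Lemma norm_sin_le1 a : `|sin a| <= 1.
Proof. by rewrite ler_norml sin_geN1 sin_le1. Qed.

Lemma spin_map_continuous s : continuous (spin_map s).
Proof.
have ac z : z != 0 -> {for z, continuous (fun w => s * (pi * plateau (logr w)))}.
  move=> z0; apply: continuousM; first exact: cvg_cst.
  apply: continuousM; first exact: cvg_cst.
  by apply: continuous_comp; [exact: logr_continuous|exact: plateau_continuous].
apply: (@cmul_continuous _ (fun z => cos (s * (pi * plateau (logr z))))
    (fun z => sin (s * (pi * plateau (logr z)))) 1) => z *.
- by apply: continuous_comp; [exact: ac|exact: continuous_cos].
- by apply: continuous_comp; [exact: ac|exact: continuous_sin].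
- exact: norm_cos_le1.
- exact: norm_sin_le1.
Qed.

(** The displacement of [lens] with the centre [k] frozen, which avoids the jumps of [round] in the
    proof of continuity. *)
Definition lens_at F k u x : R :=
  let w := (u - k%:~R) / (`|x| / 4) in
  `|x| / 4 * (klein_itv (F k (0 < x)) w - w).

Lemma lens_atE F k u x : `|x| <= 1 -> `|u - k%:~R| < 3 / 4 ->
  lens F u x = u + lens_at F k u x.
Proof.
move=> x1 uk; have [->|x0] := eqVneq x 0.
  by rewrite lens0 /lens_at normr0 !mul0r addr0.
have x0' : 0 < `|x| by rewrite normr_gt0.
have [<-//|rk] := eqVneq (round u) k.
(* If [k] is not the nearest integer, [u] is at distance at least 1/4 from both centres, where
   neither displacement acts. *)
have far : 4^-1 <= `|u - (round u)%:~R| /\ 4^-1 <= `|u - k%:~R|.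
  have := roundP u => ru; move: uk; rewrite ltr_norml => uk.
  have [lt|lt] : (round u < k)%R \/ (k < round u)%R by lia.
    have : (round u + 1)%:~R <= k%:~R :> R by rewrite ler_int; lia.
    by rewrite intrD => ?; split; rewrite ler_normr; apply/orP; [left|right]; lra.
  have : (k + 1)%:~R <= (round u)%:~R :> R by rewrite ler_int; lia.
  by rewrite intrD => ?; split; rewrite ler_normr; apply/orP; [right|left]; lra.
rewrite lens_out; last by lra.
rewrite /lens_at klein_itv_out ?subrr ?mulr0 ?addr0//.
rewrite normrM normfV [`|_ / 4|]ger0_norm; last by lra.
by rewrite ler_pdivlMr; lra.
Qed.

Lemma lens_map_continuous F : continuous (lens_map F).
Proof.
have bnd z : `|expR (lens F (logr z) (dirx z) - logr z)| <= expR (2^-1 : R).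
  rewrite ger0_norm ?expR_ge0// ler_expR.
  have d1 := dirx_le1 z; have := lens_dist F (logr z) (dirx z); rewrite ler_norml; lra.
apply: (@cmul_continuous _ (fun z => expR (lens F (logr z) (dirx z) - logr z))
   (fun=> 0) (expR 2^-1)) => //; last by move=> z; rewrite normr0 expR_ge0.
  2: by move=> z _; exact: cvg_cst.
move=> z z0; apply: continuous_comp; last exact: continuous_expR.
have lc := logr_continuous z0; have dc := dirx_continuous z0.
pose k := round (logr z).
suff H : {for z, continuous (fun w => lens_at F k (logr w) (dirx w))}.
  have near_k : \forall w \near z, `|logr w - k%:~R| < 3 / 4.
    have := roundP (logr z); rewrite -/k => rk.
    have lo : k%:~R - 3 / 4 < logr z by lra.
    have hi : logr z < k%:~R + 3 / 4 by lra.
    near=> w; rewrite ltr_norml.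
    have : k%:~R - 3 / 4 < logr w by near: w; exact: (cvgr_gt _ lc).
    have : logr w < k%:~R + 3 / 4 by near: w; exact: (cvgr_lt _ lc).
    lra.
  have E : \forall w \near z, lens_at F k (logr w) (dirx w) =
      lens F (logr w) (dirx w) - logr w.
    near=> w; rewrite (@lens_atE F k) ?dirx_le1//; first by rewrite [RHS]addrC addKr.
    by near: w.
  rewrite /prop_for /continuous_at -(nbhs_singleton E).
  by apply: cvg_trans H; apply: near_eq_cvg.
have wc : {for z, continuous (fun w => `|dirx w| / 4)}.
  apply: continuousM; last exact: cvg_cst.
  by apply: continuous_comp; [exact: dc|exact: norm_continuous].
(* On the vertical axis the argument of [klein_itv] blows up, but the displacement is at most twice
   the vanishing factor [|dirx w| / 4]. *)
have [d0|d0] := eqVneq (dirx z) 0.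
  rewrite /prop_for /continuous_at [X in _ --> X]/lens_at d0 normr0 !mul0r.
  apply/cvgr0Pnorm_lt => e e0; near=> w.
  have : `|dirx w| / 4 < e / 2.
    near: w; apply: (cvgr_lt _ wc); rewrite d0 normr0; lra.
  rewrite /lens_at; move: (dirx w) => x xe.
  have := klein_itv_dist (F k (0 < x)) ((logr w - k%:~R) / (`|x| / 4)).
  have x0 := normr_ge0 x; rewrite normrM [`|_ / 4|]ger0_norm; last by lra.
  move=> c2; apply: (@le_lt_trans _ _ (`|x| / 4 * 2)); last by lra.
  by apply: ler_wpM2l => //; lra.
have d0' : 0 < `|dirx z| by rewrite normr_gt0.
pose g := F k (0 < dirx z).
suff H : {for z, continuous (fun w => `|dirx w| / 4 *
    (klein_itv g ((logr w - k%:~R) / (`|dirx w| / 4)) -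
      (logr w - k%:~R) / (`|dirx w| / 4)))}.
  have sgn : \forall w \near z, (0 < dirx w) = (0 < dirx z).
    have [dp|dn] := ltP 0 (dirx z).
      by near=> w; near: w; exact: (cvgr_gt _ dc).
    have dn' : dirx z < 0 by rewrite lt_neqAle d0.
    near=> w; apply/negbTE; rewrite -leNgt ltW//; near: w; exact: (cvgr_lt _ dc).
  rewrite /prop_for /continuous_at {1}/lens_at -/g.
  apply: cvg_trans H; apply: near_eq_cvg; near=> w.
  have sw : (0 < dirx w) = (0 < dirx z) by near: w.
  by rewrite /lens_at sw.
have qc : {for z, continuous (fun w => (logr w - k%:~R) / (`|dirx w| / 4))}.
  apply: continuousM; first by apply: continuousB => //; exact: cvg_cst.
  by apply: continuousV => //; rewrite gt_eqF//; lra.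
apply: continuousM => //; apply: continuousB => //.
by apply: continuous_comp; [exact: qc|exact: klein_itv_continuous].
Unshelve. all: by end_near. Qed.

End PlaneMaps.

(** * The action of the abstract group on the plane *)

Section Action.
Variable R : realType.
Local Notation plane := (R * R)%type.
Implicit Types (z p q : plane) (u v a s : R) (F G : int -> bool -> klein) (D E : pmap).

Lemma cosDpiz a (m : int) : cos (a + pi * m%:~R) = (-1) ^+ oddz m * cos a.
Proof.
have nat_case (n : nat) b : cos (b + pi * n%:R) = (-1) ^+ odd n * cos b.
  elim: n => [|n IH]; first by rewrite mulr0 addr0 mul1r.
  rewrite -addn1 natrD mulrDr mulr1 addrA cosDpi IH addn1 /=.
  by case: (odd n); rewrite !(mulN1r, mul1r, opprK).
case: m => n; first exact: nat_case.
rewrite NegzE oddzN mulrNz mulrN -{2}[a](subrK (pi * n.+1%:R)) nat_case.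
by rewrite /oddz /= mulrA -expr2 sqrr_sign mul1r.
Qed.

Lemma sinDpiz a (m : int) : sin (a + pi * m%:~R) = (-1) ^+ oddz m * sin a.
Proof. by rewrite -!cosBpihalf addrAC cosDpiz. Qed.

Lemma pol_parity u a (m n : int) : oddz m = oddz n ->
  pol u (a + pi * m%:~R) = pol u (a + pi * n%:~R).
Proof. by move=> mn; rewrite /pol !cosDpiz !sinDpiz mn. Qed.

Definition pmap_act D u a : plane :=
  pol (lens (plens D) u (cos a) + (pscale D)%:~R)
      (a + pi * ((ptwist D)%:~R * plateau u + (pturn D : nat)%:Z%:~R)).

Definition realizes D (g : plane -> plane) :=
  g 0 = 0 /\ forall u a, g (pol u a) = pmap_act D u a.

(** Lens maps do not change [plateau], so the twist angle is unaffected by them. Where a lens can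
    act, [plateau] is an integer, so [E] turns by a multiple of pi: the cosine changes at most its
    sign, as recorded by [pswap]. *)
Lemma realizes_act D E g u a : realizes D g ->
  g (pmap_act E u a) = pmap_act (D * E)%g u a.
Proof.
move=> [_ gD]; rewrite gD /pmap_act.
set c := cos a; set v := lens (plens E) u c.
have c1 : `|c| <= 1 by exact: norm_cos_le1.
have pv : plateau v = plateau u by exact: plateau_lens.
set a' := a + _; have -> : lens (plens D) (v + (pscale E)%:~R) (cos a') =
    lens (plens (D * E)%g) u c + (pscale E)%:~R.
  rewrite lensD; congr (_ + _).
  rewrite -(lensM (fun k b => plens D (k + pscale E) (b (+) pswap E k)))//.
  apply: eq_lens => //; first exact: norm_cos_le1.
  move=> vk; have := plateau_near vk; rewrite pv => pu.
  have -> : cos a' = (-1) ^+ pswap E (round v) * c.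
    rewrite /a' pu -intrM -intrD cosDpiz oddzD; congr ((-1) ^+ nat_of_bool _ * _).
    by rewrite /pswap; case: (pturn E).
  split; first by rewrite normrM normr_sign mul1r.
  case: (pswap E (round v)); rewrite ?mul1r ?addbF// mulN1r oppr_eq0 oppr_gt0 => c0.
  by rewrite addbT; congr plens; case: ltgtP c0.
have -> : plateau (v + (pscale E)%:~R) = plateau u + (pscale E)%:~R by rewrite plateauD pv.
rewrite -addrA -intrD [pscale E + _]addrC.
pose m := (pturn D : nat)%:Z + (pturn E : nat)%:Z + ptwist D * pscale E.
pose t := a + pi * ((ptwist D + ptwist E)%:~R * plateau u).
have -> : a' + pi * ((ptwist D)%:~R * (plateau u + (pscale E)%:~R) +
    (pturn D : nat)%:Z%:~R) = t + pi * m%:~R.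
  by rewrite /a' /t /m !intrD intrM; ring.
rewrite mulrDr addrA -/t; apply: pol_parity.
by rewrite /m !oddzD /=; case: (pturn D); case: (pturn E); case: (oddz (_ * _)).
Qed.

Lemma realizesM D E g h : realizes D g -> realizes E h -> realizes (D * E)%g (g \o h).
Proof.
move=> gD [h0 hE]; split; first by rewrite /= h0; case: gD.
by move=> u a; rewrite /= hE; apply: realizes_act.
Qed.

Lemma pmap_act1 u a : pmap_act 1%g u a = pol u a.
Proof. by rewrite /pmap_act lens1 addr0 /= mul0r addr0 mulr0 addr0. Qed.

Lemma realizes1 : realizes 1%g id.
Proof. by split=> // u a; rewrite pmap_act1. Qed.

Lemma realizes_uniq D g h : realizes D g -> realizes D h -> g =1 h.
Proof.
move=> [g0 gD] [h0 hD]; apply: plane_ext => [|u a]; first by rewrite g0 h0.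
by rewrite gD hD.
Qed.

Lemma realizesV D g h : realizes D g -> cancel g h -> realizes D^-1%g h.
Proof.
move=> gD gK; split; first by case: gD => g0 _; rewrite -{1}g0 gK.
move=> u a; rewrite -[RHS]gK (realizes_act _ _ _ gD) mulgV pmap_act1 //.
Qed.

Lemma pol_inj_logr u v a a' : pol u a = pol v a' -> u = v.
Proof. by move=> /(congr1 (@logr R)); rewrite !logr_pol. Qed.

Lemma pol_inj_cos u a a' : pol u a = pol u a' -> cos a = cos a'.
Proof. by move=> /(congr1 (@dirx R)); rewrite !dirx_pol. Qed.

Lemma pol_inj_sin u a a' : pol u a = pol u a' -> sin a = sin a'.
Proof.
by move=> /(congr1 snd) /= /mulfI; apply; rewrite gt_eqF ?expR_gt0.
Qed.

(** The scale is read off on the vertical axis, which the lenses fix, and the half-turn at radius 1,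
    where [plateau] is 0. A nonzero twist j would give a half-turn where [plateau] is 1/|j|. The
    lens factors show at the angles 0 and pi, where the lenses are widest. *)
Lemma realizes_faithful D : realizes D id -> D = 1%g.
Proof.
move=> [_ H].
have i0 : pscale D = 0.
  have := H 0 (pi / 2); rewrite /pmap_act cos_pihalf lens0 add0r => /pol_inj_logr.
  by move/eqP; rewrite eq_sym intr_eq0 => /eqP.
have Hc u a : cos a = cos (a + pi * ((ptwist D)%:~R * plateau u + (pturn D : nat)%:Z%:~R)).
  have := H u a; rewrite /pmap_act => E.
  by apply: (@pol_inj_cos u); rewrite {1}E (esym (pol_inj_logr E)).
have p0 : plateau (0 : R) = 0.
  by rewrite (@plateau_near _ 0 0)// subr0 normr0 invr_ge0; lra.
have l0 : pturn D = false.
  have := Hc 0 0; rewrite p0 mulr0 [0 + _%:~R]add0r cosDpiz cos0 mulr1.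
  by case: (pturn D) => //=; rewrite /oddz /= expr1; lra.
have j0 : ptwist D = 0.
  apply/eqP; apply/negPn/negP => jn0.
  have jR : 0 < `|(ptwist D)%:~R : R| by rewrite normr_gt0 intr_eq0.
  have j1 : 1 <= `|(ptwist D)%:~R : R|.
    by rewrite -intr_norm ler1z; lia.
  pose t : R := `|(ptwist D)%:~R|^-1.
  have t1 : 0 < t <= 1 by rewrite invr_gt0 jR invf_le1.
  have := Hc (4^-1 + t / 2) 0; rewrite plateau_slope; last lra.
  have -> : 2 * (4^-1 + t / 2) - 2^-1 = t by lra.
  rewrite l0 addr0 add0r cos0.
  have -> : cos (pi * ((ptwist D)%:~R * t)) = -1.
    rewrite /t; case: (ltgtP (ptwist D) 0) jn0 => // jlt _.
      rewrite ltr0_norm ?ltrz0// invrN mulrN divff ?intr_eq0 ?lt_eqF//.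
      by rewrite mulrN mulr1 cosN cospi.
    by rewrite gtr0_norm ?ltr0z// divff ?intr_eq0 ?gt_eqF// mulr1 cospi.
  lra.
apply: pmap_ext => // k b /=; apply: (@klein_itv_faithful R) => w.
pose a : R := if b then 0 else pi.
have ca : `|cos a| = 1 by rewrite /a; case: (b); rewrite ?cos0 ?cospi ?normrN ?normr1.
have sa : (0 < cos a) = b.
  by rewrite /a; case: (b); rewrite ?cos0 ?cospi; [rewrite ltr01|rewrite oppr_gt0 ltr10].
have [w1|w1] := ltP `|w| 1; last by rewrite klein_itv_out.
have ru : round (k%:~R + w / 4) = k.
  by apply: round_uniq; move: w1; rewrite ltr_norml; lra.
have := H (k%:~R + w / 4) a; rewrite /pmap_act i0 addr0 => /pol_inj_logr.
rewrite /lens ru sa ca [_ + w / 4 - _]addrC addKr => E.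
have E4 : w / 4 / (1 / 4) = w by lra.
by move: E; rewrite E4; lra.
Qed.

Lemma scale_map_realizes : realizes pmap_c (@scale_map R 1).
Proof.
split=> [|u a]; first exact: cmul0.
by rewrite scale_map_pol /pmap_act lens1 /= mul0r addr0 mulr0 addr0.
Qed.

Lemma lens_map_realizes F : realizes (Pmap 0 0 false F) (@lens_map R F).
Proof.
split=> [|u a]; first exact: cmul0.
by rewrite lens_map_pol /pmap_act /= mul0r !addr0 mulr0 addr0.
Qed.

Lemma spin_map_realizes : realizes (Pmap 0 1 false (fun _ _ => 1%g)) (@spin_map R 1).
Proof.
split=> [|u a]; first exact: cmul0.
by rewrite spin_map_pol /pmap_act lens1 /= !mul1r !addr0.
Qed.

Lemma scale_mapK v : cancel (@scale_map R v) (scale_map (- v)).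
Proof.
apply: plane_ext => [|u a]; first by rewrite /scale_map !cmul0.
by rewrite !scale_map_pol addrK.
Qed.

Lemma spin_mapK s : cancel (@spin_map R s) (spin_map (- s)).
Proof.
apply: plane_ext => [|u a]; first by rewrite /spin_map !cmul0.
by rewrite !spin_map_pol mulNr addrK.
Qed.

Lemma lens_mapK F G : (forall k b, G k b * F k b = 1)%g ->
  cancel (@lens_map R F) (lens_map G).
Proof.
move=> GF; apply: plane_ext => [|u a]; first by rewrite /lens_map !cmul0.
rewrite !lens_map_pol lensM ?norm_cos_le1//; congr pol.
rewrite -[RHS](lens1 _ (cos a)); congr lens.
by apply/funext => k; apply/funext => b; rewrite GF.
Qed.

End Action.

(** * Winding numbers *)

Section Winding.
Variable R : realType.
Local Notation plane := (R * R)%type.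
Implicit Types (p q : plane) (c : R -> plane) (k : int).

(** The tangent half-angle formula. It provides a continuous argument of (A, B) off the closed
    negative half-axis. *)
Lemma half_angle (A B : R) : let N := Num.sqrt (A ^+ 2 + B ^+ 2) in 0 < N + A ->
  A = N * cos (2 * atan (B / (N + A))) /\ B = N * sin (2 * atan (B / (N + A))).
Proof.
move=> N NA; set h := B / (N + A).
have N2 : N ^+ 2 = A ^+ 2 + B ^+ 2 by rewrite sqr_sqrtr// addr_ge0 ?sqr_ge0.
have N0 : 0 <= N by exact: sqrtr_ge0.
have Np : 0 < N.
  rewrite lt0r N0 andbT; apply/negP => /eqP n0; move: N2; rewrite n0 expr0n /=.
  by move: NA; rewrite n0 add0r; nra.
have h2 : 1 + h ^+ 2 = 2 * N / (N + A).
  have E : (N + A) ^+ 2 + B ^+ 2 = 2 * N * (N + A) by rewrite sqrrD; lra.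
  rewrite /h expr_div_n -[X in X + _](@divff _ ((N + A) ^+ 2)); last first.
    by rewrite expf_neq0// gt_eqF.
  by rewrite -mulrDl E expr2 -mulf_div divff ?mulr1// gt_eqF.
have h0 : 0 < 1 + h ^+ 2 by have := sqr_ge0 h; lra.
have c2 : cos (atan h) ^+ 2 = (1 + h ^+ 2)^-1.
  by rewrite cos_atan exprVn sqr_sqrtr// ltW.
have s1 : sin (atan h) = h * cos (atan h).
  have e : sin (atan h) / cos (atan h) = h by have := atanK h; rewrite /tan.
  by rewrite -{2}e divfK// cos_atan invr_eq0 gt_eqF// sqrtr_gt0.
have NAn : N + A != 0 by rewrite gt_eqF.
have Nn : N != 0 by rewrite gt_eqF.
have -> : 2 * atan h = atan h + atan h by lra.
rewrite cosD sinD s1.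
have -> : cos (atan h) * cos (atan h) - h * cos (atan h) * (h * cos (atan h)) =
  (2 - (1 + h ^+ 2)) * cos (atan h) ^+ 2 by ring.
have -> : h * cos (atan h) * cos (atan h) + cos (atan h) * (h * cos (atan h)) =
  2 * h * cos (atan h) ^+ 2 by ring.
rewrite c2 h2 /h; split; field; by rewrite NAn Nn.
Qed.

Lemma within_continuous_in (V : topologicalType) (A : set R) (f : R -> V) :
  (forall t : subspace A, A t -> {for t, continuous (f : subspace A -> V)}) ->
  {within A, continuous f}.
Proof.
move=> H t; have [/H//|nA] := EM (A t).
move=> U Ut; rewrite /nbhs /= -nbhs_subspace_out// => s ->.
exact: nbhs_singleton Ut.
Qed.

Lemma within_comp (U V : topologicalType) (A : set R) (f : R -> U) (g : U -> V) :
  {within A, continuous f} -> (forall t, A t -> {for f t, continuous g}) ->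
  {within A, continuous (fun t => g (f t))}.
Proof.
move=> fc gc; apply: within_continuous_in => t At.
by apply: (@continuous_comp (subspace A) _ _ f g t); [exact: fc|exact: gc].
Qed.

Lemma withinD (A : set R) (f g : R -> R) : {within A, continuous f} ->
  {within A, continuous g} -> {within A, continuous (fun t => f t + g t)}.
Proof. by move=> fc gc t; exact: (continuousD (fc t) (gc t)). Qed.

Lemma withinB (A : set R) (f g : R -> R) : {within A, continuous f} ->
  {within A, continuous g} -> {within A, continuous (fun t => f t - g t)}.
Proof. by move=> fc gc t; exact: (continuousB (fc t) (gc t)). Qed.

Lemma withinM (A : set R) (f g : R -> R) : {within A, continuous f} ->
  {within A, continuous g} -> {within A, continuous (fun t => f t * g t)}.
Proof. by move=> fc gc t; exact: (continuousM (fc t) (gc t)). Qed.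

Lemma within_cst (A : set R) (x : R) : {within A, continuous (fun=> x)}.
Proof. by move=> t; exact: cvg_cst. Qed.

Lemma within_pair (A : set R) (f g : R -> R) : {within A, continuous f} ->
  {within A, continuous g} -> {within A, continuous (fun t => (f t, g t) : plane)}.
Proof. by move=> fc gc t; exact: (continuous_pair (fc t) (gc t)). Qed.

(* If the displacement of [c2] from [p2] never points opposite to that of [c1]
   from [p1], the angle between the two is a continuous function of time. *)
Lemma winding_number_near c1 c2 p1 p2 k :
  {within `[0, 1], continuous c2} -> c2 0 = c2 1 ->
  (forall t, t \in `[0, 1] -> c2 t <> p2) ->
  (forall t l, t \in `[0, 1] -> 0 < l -> c2 t - p2 <> - l *: (c1 t - p1)) ->
  winding_number c1 p1 k -> winding_number c2 p2 k.
Proof.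
move=> c2c c201 c2p na [rad [theta [thc radP thk]]].
pose X t : R := (c2 t).1 - p2.1; pose Y t : R := (c2 t).2 - p2.2.
(* [A] and [B] are the coordinates of the second displacement in the frame turned by [theta], so
   [del] is the angle from the first displacement to the second. *)
pose A t := X t * cos (theta t) + Y t * sin (theta t).
pose B t := Y t * cos (theta t) - X t * sin (theta t).
pose N t := Num.sqrt (A t ^+ 2 + B t ^+ 2).
pose del t := 2 * atan (B t / (N t + A t)).
have XE t : X t = A t * cos (theta t) - B t * sin (theta t).
  have := cos2Dsin2 (theta t); rewrite /A /B => cs.
  by rewrite -[LHS]mulr1 -cs; ring.
have YE t : Y t = A t * sin (theta t) + B t * cos (theta t).
  have := cos2Dsin2 (theta t); rewrite /A /B => cs.
  by rewrite -[LHS]mulr1 -cs; ring.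
have NAp t : t \in `[0, 1] -> 0 < N t + A t.
  move=> t01; rewrite ltNge; apply/negP => NA.
  have N0 : 0 <= N t by exact: sqrtr_ge0.
  have N2 : N t ^+ 2 = A t ^+ 2 + B t ^+ 2 by rewrite sqr_sqrtr// addr_ge0 ?sqr_ge0.
  have B0 : B t = 0 by apply/eqP; rewrite -sqrf_eq0; apply/eqP; have := sqr_ge0 (B t); nra.
  have [A0|A0] := eqVneq (A t) 0.
    apply: (c2p t t01); have := XE t; have := YE t; rewrite A0 B0 !mul0r subr0 addr0.
    rewrite /X /Y => /eqP; rewrite subr_eq0 => /eqP y /eqP; rewrite subr_eq0 => /eqP x.
    by rewrite [LHS]surjective_pairing x y -surjective_pairing.
  have An : A t < 0 by rewrite lt_neqAle A0; lra.
  have [r0 c1E] := radP t t01.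
  apply: (na t (- A t / rad t) t01); first by rewrite divr_gt0//; lra.
  rewrite c1E mulNr opprK.
  have Xt := XE t; have Yt := YE t; rewrite B0 mul0r subr0 in Xt.
  rewrite B0 mul0r addr0 in Yt.
  rewrite [LHS]surjective_pairing [RHS]surjective_pairing /= -/(X t) -/(Y t) Xt Yt.
  rewrite ![p1.1 + _ - _]addrC ![p1.2 + _ - _]addrC !addKr /GRing.scale /=.
  by rewrite !mulrA divfK// gt_eqF.
have Np t : t \in `[0, 1] -> 0 < N t.
  move=> t01; have NA := NAp t t01; rewrite lt0r [0 <= N t]sqrtr_ge0 andbT.
  apply/negP => /eqP n0.
  have : N t ^+ 2 = A t ^+ 2 + B t ^+ 2 by rewrite sqr_sqrtr// addr_ge0 ?sqr_ge0.
  move: NA; rewrite n0 expr0n /= add0r => NA N2.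
  have := sqr_ge0 (B t); nra.
exists N, (fun t => theta t + del t); split.
- have Xc : {within `[0, 1], continuous X}.
    apply: withinB; last exact: within_cst.
    by apply: (within_comp c2c) => t _; exact: continuous_fst.
  have Yc : {within `[0, 1], continuous Y}.
    apply: withinB; last exact: within_cst.
    by apply: (within_comp c2c) => t _; exact: continuous_snd.
  have Cc : {within `[0, 1], continuous (fun t => cos (theta t))}.
    by apply: (within_comp thc) => t _; exact: continuous_cos.
  have Sc : {within `[0, 1], continuous (fun t => sin (theta t))}.
    by apply: (within_comp thc) => t _; exact: continuous_sin.
  have Ac : {within `[0, 1], continuous A} by apply: withinD; exact: withinM.
  have Bc : {within `[0, 1], continuous B} by apply: withinB; exact: withinM.
  have Nc : {within `[0, 1], continuous N}.
    have ABc : {within `[0, 1], continuous (fun t => A t ^+ 2 + B t ^+ 2)}.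
      by apply: withinD; exact: withinM.
    by apply: (within_comp ABc) => t _; exact: sqrt_continuous.
  apply: withinD => //; apply: withinM; first exact: within_cst.
  have qc : {within `[0, 1], continuous (fun t => B t / (N t + A t))}.
    apply: withinM => //; apply: (within_comp (withinD Nc Ac)) => t t01.
    by apply: inv_continuous; rewrite gt_eqF// NAp.
  by apply: (within_comp qc) => t _; exact: continuous_atan.
- move=> t t01; split; first exact: Np.
  have [An Bn] : A t = N t * cos (del t) /\ B t = N t * sin (del t).
    exact: half_angle (NAp t t01).
  rewrite cosD sinD [LHS]surjective_pairing; congr pair.
    rewrite -[LHS](subrK p2.1) -/(X t) [LHS]addrC; congr (_ + _).
    by rewrite [LHS]XE An Bn; ring.
  rewrite -[LHS](subrK p2.2) -/(Y t) [LHS]addrC; congr (_ + _).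
  by rewrite [LHS]YE An Bn; ring.
(* Over the loop [theta] changes by an even multiple of pi, so the frame and hence [del] return to
   their initial values. *)
- have th1 : theta 1 = theta 0 + pi * (2 * k)%:~R.
    by rewrite intrM; have := thk; lra.
  have c1E : cos (theta 1) = cos (theta 0).
    by rewrite th1 cosDpiz /oddz abszM oddM mul1r.
  have s1E : sin (theta 1) = sin (theta 0).
    by rewrite th1 sinDpiz /oddz abszM oddM mul1r.
  have A1 : A 1 = A 0 by rewrite /A /X /Y -c201 c1E s1E.
  have B1 : B 1 = B 0 by rewrite /B /X /Y -c201 c1E s1E.
  have -> : del 1 = del 0 by rewrite /del /N A1 B1.
  by rewrite -thk; ring.
Qed.

End Winding.

(** * The three kinds of plane maps preserve orientation *)

Section Orientation.
Variable R : realType.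
Local Notation plane := (R * R)%type.
Implicit Types (p q z : plane) (c : R -> plane) (k : int) (h : plane -> plane).

Lemma plane_scale_eq0 (l : R) z : 0 < l -> l *: z = 0 -> z = 0.
Proof. by move=> l0 /eqP; rewrite scaler_eq0 gt_eqF//= => /eqP. Qed.

(** The condition on opposite displacements is symmetric: exchanging the loop and its image replaces
    [l] by its inverse, so [winding_number_near] serves both directions. *)
Lemma orientation_preserving_near h : continuous h -> injective h ->
  (forall p q l, 0 < l -> q <> p -> h q - h p <> - l *: (q - p)) ->
  orientation_preserving h.
Proof.
move=> hc hi na c p cp k; have [hcc hc01 hcp] := loop_avoiding_comp hc hi cp.
have [cc c01 cp'] := cp.
split; apply: winding_number_near => //.
  by move=> t l t01 l0; apply: na => //; exact: cp'.
move=> t l t01 l0 E; apply: (na p (c t) l^-1); first by rewrite invr_gt0.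
  exact: cp'.
by rewrite E scalerA mulrNN mulVf ?scale1r// gt_eqF.
Qed.

Lemma cmulr_scale (a : R) z : cmul a 0 z = a *: z.
Proof. by rewrite /cmul !mul0r subr0 add0r [RHS]surjective_pairing. Qed.

Lemma scale_map_orientation v : orientation_preserving (@scale_map R v).
Proof.
apply: orientation_preserving_near; first exact: scale_map_continuous.
  exact: (can_inj (@scale_mapK R v)).
move=> p q l l0 qp; rewrite /scale_map !cmulr_scale -scalerBr scaleNr => /eqP.
rewrite -subr_eq0 opprK -scalerDl => /eqP /plane_scale_eq0 H; apply: qp.
by apply/eqP; rewrite -subr_eq0; apply/eqP; apply: H; have := expR_gt0 v; lra.
Qed.

Lemma pol_scale (v u a : R) : expR v *: pol u a = pol (u + v) a.
Proof. by rewrite -cmulr_scale -/(scale_map v _) scale_map_pol. Qed.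

Lemma pol_sub (u v a : R) : pol v a - pol u a = (expR v - expR u) *: pol 0 a.
Proof.
rewrite [LHS]surjective_pairing [RHS]surjective_pairing /pol expR0 !mul1r /=.
by rewrite -!mulrBl.
Qed.

(** The map multiplies each point by a positive factor, so opposite displacements would put [p] and
    [q] on one ray from the origin. On a ray the map is increasing by [lens_mono]. *)
Lemma lens_map_orientation F G : (forall k b, G k b * F k b = 1)%g ->
  orientation_preserving (@lens_map R F).
Proof.
move=> GF; apply: orientation_preserving_near; first exact: lens_map_continuous.
  exact: (can_inj (@lens_mapK R F G GF)).
move=> p q l l0 qp E.
pose m z := expR (lens F (logr z) (dirx z) - logr z).
have hE z : lens_map F z = m z *: z by exact: cmulr_scale.
have ml z : 0 < m z + l by rewrite addr_gt0// expR_gt0.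
have ray : (m q + l) *: q = (m p + l) *: p.
  move: E; rewrite !hE scaleNr scalerBr opprB => /eqP.
  by rewrite subr_eq addrAC eq_sym subr_eq addrC -!scalerDl eq_sym => /eqP.
have [p0|p0] := eqVneq p 0.
  by apply: qp; rewrite p0; apply: (plane_scale_eq0 (ml q)); rewrite ray p0 scaler0.
have [q0|q0] := eqVneq q 0.
  by case/eqP: p0; apply: (plane_scale_eq0 (ml p)); rewrite -ray q0 scaler0.
have [u [a pE]] := pol_surj p0; have [v [b qE]] := pol_surj q0.
have qE' : q = pol v a.
  have [x mx] : exists x, m q + l = expR x by exists (ln (m q + l)); rewrite lnK ?posrE.
  have [y my] : exists y, m p + l = expR y by exists (ln (m p + l)); rewrite lnK ?posrE.
  move: ray; rewrite mx my {1}qE {1}pE !pol_scale => ray.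
  have xy := pol_inj_logr ray; rewrite xy in ray.
  by rewrite qE /pol (pol_inj_cos ray) (pol_inj_sin ray).
move: E; rewrite pE qE' !lens_map_pol !pol_sub scalerA => E.
have {}E : expR (lens F v (cos a)) - expR (lens F u (cos a)) = - l * (expR v - expR u).
  move/eqP: E; rewrite -subr_eq0 -scalerBl scaler_eq0 (negbTE (pol_neq0 _ _)) orbF.
  by rewrite subr_eq0 => /eqP.
have a1 := @norm_cos_le1 R a.
have [uv|vu|uv] := ltgtP u v.
- have := lens_mono F a1 uv; rewrite -ltr_expR => lt1.
  by move: uv; rewrite -ltr_expR => lt2; nra.
- have := lens_mono F a1 vu; rewrite -ltr_expR => lt1.
  by move: vu; rewrite -ltr_expR => lt2; nra.
- by apply: qp; rewrite pE qE' uv.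
Qed.

Definition rot (b : R) z : plane := cmul (cos b) (sin b) z.

Lemma rot0 z : rot 0 z = z.
Proof.
by rewrite /rot cos0 sin0 cmulr_scale scale1r.
Qed.

Lemma rotD a b z : rot (a + b) z = rot a (rot b z).
Proof. by rewrite /rot cosD sinD /cmul /=; congr pair; ring. Qed.

Lemma winding_number_rot b c p k : winding_number c p k ->
  winding_number (rot b \o c) (rot b p) k.
Proof.
move=> [rad [theta [thc radP thk]]].
exists rad, (fun t => theta t + b); split; last by rewrite -thk; ring.
  by apply: withinD => //; exact: within_cst.
move=> t t01; have [r0 cE] := radP t t01; split=> //.
by rewrite /= cE /rot /cmul /= cosD sinD; congr pair; ring.
Qed.

Lemma one_sub_cos_le (x : R) : 1 - cos x <= `|x|.
Proof.
have cosd (y : R) : is_derive y 1 cos (- sin y) by exact: is_derive_cos.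
have pos (y : R) : 0 <= y -> 1 - cos y <= y.
  rewrite le_eqVlt => /orP[/eqP <-|y0]; first by rewrite cos0; lra.
  have cc : {within `[0, y], continuous (@cos R)}.
    by apply: continuous_subspaceT => z; exact: continuous_cos.
  have [z _] := MVT y0 (fun x _ => cosd x) cc; rewrite cos0 subr0.
  by have := sin_le1 z; nra.
have [x0|x0] := leP 0 x; first by rewrite ger0_norm// pos.
by rewrite ltr0_norm// -cosN pos//; lra.
Qed.

(** The hypothesis says that rot b q + l q = (1 + l) p; the conclusion compares squared norms. *)
Lemma antipodal_rot (b l : R) p q : rot b q - p = - l *: (q - p) ->
  rho q ^+ 2 * (1 + l ^+ 2 + 2 * l * cos b) = (1 + l) ^+ 2 * rho p ^+ 2.
Proof.
rewrite !rho_sqr => E.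
have E1 : (rot b q).1 + l * q.1 = (1 + l) * p.1.
  by move: (congr1 fst E); rewrite /= /GRing.scale /=; lra.
have E2 : (rot b q).2 + l * q.2 = (1 + l) * p.2.
  by move: (congr1 snd E); rewrite /= /GRing.scale /=; lra.
have -> : (1 + l) ^+ 2 * (p.1 ^+ 2 + p.2 ^+ 2) =
  ((1 + l) * p.1) ^+ 2 + ((1 + l) * p.2) ^+ 2 by ring.
rewrite -E1 -E2 /=; have := cos2Dsin2 b => cs.
transitivity ((q.1 ^+ 2 + q.2 ^+ 2) * (cos b ^+ 2 + sin b ^+ 2 + l ^+ 2 + 2 * l * cos b)).
  by rewrite cs.
ring.
Qed.

(** In use, [x] is the squared ratio of the radii of the moving point and of [p], [u] the logarithm
    of that ratio before squaring, and [C] is 1 minus the cosine of the step angle. From 4 l <= (1 +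
    l)^2 the equation yields 2 (x - 1) <= C x, too large for so small a [C]. *)
Lemma half_turn_arith (l u C x : R) : 0 < l -> 0 < u -> 0 <= C ->
  C * (1 + 2 * u) < 4 * u -> 1 + 2 * u <= x ->
  x * ((1 + l) ^+ 2 - 2 * l * C) = (1 + l) ^+ 2 -> False.
Proof.
move=> l0 u0 C0 Cu ux E.
have l2 : 4 * l <= (1 + l) ^+ 2 by have := sqr_ge0 (1 - l); lra.
have l2' : 0 < (1 + l) ^+ 2 by rewrite exprn_gt0//; lra.
have Cx0 : 0 <= C * x by rewrite mulr_ge0//; lra.
have h2 : 2 * l * (C * x) <= (1 + l) ^+ 2 / 2 * (C * x).
  by rewrite ler_wpM2r//; lra.
have h3 : 2 * (x - 1) <= C * x.
  rewrite -(ler_pM2l l2'); lra.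
have C2 : 0 < 2 - C by rewrite -(@pmulr_lgt0 _ (1 + 2 * u)); lra.
have : (1 + 2 * u) * (2 - C) <= x * (2 - C) by rewrite ler_pM2r.
lra.
Qed.

Lemma bounded_within (f : R -> R) : {within `[0, 1], continuous f} ->
  exists M, forall t, t \in `[0, 1] -> f t <= M.
Proof.
move=> fc; have [c _ cP] := EVT_max (@ler01 R) fc.
by exists (f c) => t; apply: cP.
Qed.

Lemma rot_within (c : R -> plane) (f : R -> R) : {within `[0, 1], continuous c} ->
  {within `[0, 1], continuous f} ->
  {within `[0, 1], continuous (fun t => rot (f t) (c t))}.
Proof.
move=> cc fc; have c1 : {within `[0, 1], continuous (fun t => (c t).1)}.
  by apply: (within_comp cc) => t _; exact: continuous_fst.
have c2 : {within `[0, 1], continuous (fun t => (c t).2)}.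
  by apply: (within_comp cc) => t _; exact: continuous_snd.
have co : {within `[0, 1], continuous (fun t => cos (f t))}.
  by apply: (within_comp fc) => t _; exact: continuous_cos.
have si : {within `[0, 1], continuous (fun t => sin (f t))}.
  by apply: (within_comp fc) => t _; exact: continuous_sin.
by apply: within_pair; [apply: withinB|apply: withinD]; exact: withinM.
Qed.

(* Outside the disk of radius [rho p] the twist, normalized to fix [p], is the end of the
   isotopy which turns the circle of radius [r] by [sigma * phi r]; each small
   step of it moves the displacement from [p] by less than a half-turn. *)
Lemma spin_map_winding (s : R) c p k : loop_avoiding c p ->
  winding_number c p k -> winding_number (spin_map s \o c) (spin_map s p) k.
Proof.
move=> [cc c01 cp] wc.
(* Around the origin the twist adds to the polar angle a continuous function of the point of the
   loop, with equal values at both ends. *)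
have [p0|p0] := eqVneq p 0.
  rewrite p0 /spin_map cmul0; move: wc => [rad [theta [thc radP thk]]].
  have cn0 t : t \in `[0, 1] -> c t != 0.
    by move=> t01; apply/eqP; rewrite -p0; exact: cp.
  exists rad, (fun t => theta t + s * (pi * plateau (logr (c t)))); split.
  - apply: withinD => //; apply: withinM; first exact: within_cst.
    apply: withinM; first exact: within_cst.
    have lc : {within `[0, 1], continuous (fun t => logr (c t))}.
      by apply: (within_comp cc) => t t01; apply: logr_continuous; exact: cn0.
    by apply: (within_comp lc) => t _; exact: plateau_continuous.
  - move=> t t01; have [r0 cE] := radP t t01; split=> //.
    rewrite /= {3}cE p0 /cmul /= !add0r cosD sinD; congr pair; ring.
  - by rewrite -c01 -thk; ring.
have r0 : 0 < rho p by rewrite rho_gt0.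
(* The maximum with [rho p] freezes the twist inside the disk, so [phi] vanishes there. *)
pose U t := ln (Num.max (rho (c t)) (rho p)) - logr p.
pose phi t := s * (pi * (plateau (ln (Num.max (rho (c t)) (rho p))) - plateau (logr p))).
have mx t : 0 < Num.max (rho (c t)) (rho p) by rewrite lt_max r0 orbT.
have mc : {within `[0, 1], continuous (fun t => ln (Num.max (rho (c t)) (rho p)))}.
  have rc : {within `[0, 1], continuous (fun t => rho (c t))}.
    by apply: (within_comp cc) => t _; exact: rho_continuous.
  have mxc : {within `[0, 1], continuous (fun t => Num.max (rho (c t)) (rho p))}.
    by move=> t; exact: (continuous_max (rc t) (@within_cst _ _ (rho p) t)).
  by apply: (within_comp mxc) => t _; apply: continuous_ln; exact: mx.
have phic : {within `[0, 1], continuous phi}.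
  apply: withinM; first exact: within_cst.
  apply: withinM; first exact: within_cst.
  apply: withinB; last exact: within_cst.
  by apply: (within_comp mc) => t _; exact: plateau_continuous.
have [M UM] : exists M, forall t, t \in `[0, 1] -> U t <= M.
  by apply: bounded_within; apply: withinB => //; exact: within_cst.
have U0 t : 0 <= U t.
  by rewrite subr_ge0 ler_ln ?posrE// le_max lexx orbT.
have piR : 0 < pi :> R by exact: pi_gt0.
pose K := `|s| * pi * 2.
have K0 : 0 <= K by rewrite !mulr_ge0// pi_ge0.
have phiU t : `|phi t| <= K * U t.
  have lU : logr p <= ln (Num.max (rho (c t)) (rho p)) by have := U0 t; rewrite subr_ge0.
  have := plateau_lip lU; rewrite -/(U t) => pl.
  rewrite /phi /K !normrM (ger0_norm (ltW piR)) -!mulrA ler_wpM2l//.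
  by rewrite ler_pM2l// ger0_norm; lra.
have inner t : rho (c t) <= rho p -> phi t = 0.
  by move=> cp0; rewrite /phi max_r// subrr !mulr0.
pose Q (sg : R) t := rot (sg * phi t) (c t).
have rhoQ sg t : rho (Q sg t) = rho (c t) by exact: rho_rot.
have Qc sg : {within `[0, 1], continuous (Q sg)}.
  by apply: rot_within => //; apply: withinM => //; exact: within_cst.
have phi01 : phi 0 = phi 1 by rewrite /phi c01.
have Q01 sg : Q sg 0 = Q sg 1 by rewrite /Q phi01 c01.
have Qp sg t : t \in `[0, 1] -> Q sg t <> p.
  move=> t01 E; have : rho (c t) = rho p by rewrite -(rhoQ sg) E.
  move=> rE; apply: (cp t t01); rewrite -E /Q inner ?rE//.
  by rewrite mulr0 rot0.
(* [M] bounds [U] along the whole loop, so the admissible step size [d] depends neither on [t] nor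
   on [sg]. *)
have step sg d : `|d| * K * (1 + 2 * `|M|) < 4 ->
    winding_number (Q sg) p k -> winding_number (Q (sg + d)) p k.
  move=> dK; apply: (winding_number_near (Qc _) (Q01 _) (@Qp _)) => t l t01 l0 E.
  have Q' : Q (sg + d) t = rot (d * phi t) (Q sg t).
    by rewrite /Q -rotD; congr rot; ring.
  rewrite Q' in E; have := antipodal_rot E; rewrite rhoQ => EE.
  have [rc|rc] := leP (rho (c t)) (rho p).
    move: E; rewrite inner// mulr0 rot0 scaleNr => /eqP; rewrite -subr_eq0 opprK.
    rewrite -{1}[Q sg t - p]scale1r -scalerDl => /eqP /plane_scale_eq0 H.
    apply: (@Qp sg t t01); apply/eqP; rewrite -subr_eq0; apply/eqP; apply: H; lra.
  have eU : rho (c t) = rho p * expR (U t).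
    have rc0 := lt_trans r0 rc.
    rewrite /U max_l ?(ltW rc)// expRD expRN /logr !lnK ?posrE//.
    by rewrite mulrC divfK// gt_eqF.
  have e2 : 1 + 2 * U t <= expR (U t) ^+ 2.
    by rewrite -expRM_natl; apply: expR_ge1Dx.
  have Upos : 0 < U t.
    rewrite lt0r U0 andbT; apply/eqP => u0; move: eU; rewrite u0 expR0 mulr1 => rE.
    by rewrite rE ltxx in rc.
  have UMt : U t <= `|M| by apply: le_trans (UM t t01) _; exact: ler_norm.
  have c1 := one_sub_cos_le (d * phi t).
  have c2 : `|d * phi t| <= `|d| * (K * U t).
    by rewrite normrM ler_wpM2l.
  have small : `|d| * (K * U t) * (1 + 2 * U t) < 4 * U t.
    have dK0 : 0 <= `|d| * K by rewrite mulr_ge0.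
    have H : `|d| * K * (1 + 2 * U t) <= `|d| * K * (1 + 2 * `|M|).
      by rewrite ler_wpM2l//; lra.
    have -> : `|d| * (K * U t) * (1 + 2 * U t) = `|d| * K * (1 + 2 * U t) * U t by ring.
    by rewrite ltr_pM2r//; lra.
  pose C := 1 - cos (d * phi t); pose x := expR (U t) ^+ 2.
  have EC : x * ((1 + l) ^+ 2 - 2 * l * C) = (1 + l) ^+ 2.
    apply: (@mulfI _ (rho p ^+ 2)); first by rewrite expf_neq0// gt_eqF.
    by rewrite [RHS]mulrC -EE eU /x /C; ring.
  have C0 : 0 <= C by rewrite subr_ge0 cos_le1.
  have CU : C * (1 + 2 * U t) < 4 * U t.
    apply: le_lt_trans small; rewrite ler_wpM2r//; first lra.
    exact: le_trans c2.
  exact: (half_turn_arith l0 Upos C0 CU e2 EC).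
have [N NK] : exists N : nat, K * (1 + 2 * `|M|) < 4 * N.+1%:R.
  exists (Num.truncn (K * (1 + 2 * `|M|))).
  have := truncnS_gt (K * (1 + 2 * `|M|)).
  have : 0 <= (Num.truncn (K * (1 + 2 * `|M|))).+1%:R :> R by [].
  lra.
have Q1 : winding_number (Q 1) p k.
  have Qj (j : nat) : winding_number (Q (j%:R / N.+1%:R)) p k.
    elim: j => [|j IH].
      have -> : Q (0 / N.+1%:R) = c by apply/funext => t; rewrite /Q mul0r mul0r rot0.
      exact: wc.
    rewrite -natr1 mulrDl mul1r; apply: step => //.
    rewrite gtr0_norm ?invr_gt0// -mulrA mulrC ltr_pdivrMr//; lra.
  by have := Qj N.+1; rewrite divff// pnatr_eq0.
(* [W] is the full twist followed by the rotation that brings [p] back. It agrees with [Q 1] outside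
   the disk; inside, the points are closer to the origin than [p], and by [antipodal_rot] no
   rotation can reverse their displacement from [p]. *)
pose b0 := s * (pi * plateau (logr p)).
pose W t := rot (- b0) (spin_map s (c t)).
have spc : {within `[0, 1], continuous (fun t => spin_map s (c t))}.
  by apply: (within_comp cc) => t _; exact: spin_map_continuous.
have WE t : W t = rot (s * (pi * (plateau (logr (c t)) - plateau (logr p))) - phi t) (Q 1 t).
  by rewrite /W /Q /spin_map -/(rot _ _) -!rotD; congr rot; rewrite /b0; ring.
have Wp t : t \in `[0, 1] -> W t <> p.
  move=> t01 E; have spE : spin_map s (c t) = spin_map s p.
    by rewrite /spin_map -!/(rot _ _) -/b0 -[in RHS]E /W -rotD subrr rot0.
  exact: (cp t t01 (can_inj (spin_mapK s) spE)).
have wW : winding_number W p k.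
  apply: (winding_number_near _ _ Wp _ Q1).
  - by apply: rot_within => //; exact: within_cst.
  - by rewrite /W c01.
  move=> t l t01 l0 E; have [rc|rc] := leP (rho p) (rho (c t)).
    have EW : W t = Q 1 t by rewrite WE /phi max_l// subrr rot0.
    move: E; rewrite EW scaleNr => /eqP; rewrite -subr_eq0 opprK.
    rewrite -{1}[Q 1 t - p]scale1r -scalerDl => /eqP /plane_scale_eq0 H.
    apply: (@Qp 1 t t01); apply/eqP; rewrite -subr_eq0; apply/eqP; apply: H; lra.
  move: E; rewrite WE => /antipodal_rot; rewrite rhoQ.
  set cs := cos _ => EE; have cs1 : cs <= 1 by exact: cos_le1.
  have rr : rho (c t) ^+ 2 < rho p ^+ 2 by rewrite ltr_pXn2r// nnegrE ?rho_ge0.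
  have l2' : 0 < (1 + l) ^+ 2 by rewrite exprn_gt0//; lra.
  have : rho (c t) ^+ 2 * (1 + l ^+ 2 + 2 * l * cs) <= rho (c t) ^+ 2 * (1 + l) ^+ 2.
    by rewrite ler_wpM2l ?sqr_ge0//; nra.
  nra.
have := winding_number_rot b0 wW; rewrite -/(spin_map s p).
have -> : rot b0 \o W = spin_map s \o c; last by [].
by apply/funext => t; rewrite /= /W -rotD subrr rot0.
Qed.

(** The converse implication is the forward one for the inverse twist [spin_map (- s)]. *)
Lemma spin_map_orientation (s : R) : orientation_preserving (@spin_map R s).
Proof.
move=> c p cp k; split; first exact: spin_map_winding.
have inj := can_inj (@spin_mapK R s).
have lp := loop_avoiding_comp (@spin_map_continuous R s) inj cp.
move=> /(spin_map_winding (- s) lp); rewrite spin_mapK.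
by have -> : spin_map (- s) \o (spin_map s \o c) = c by apply/funext => t; rewrite /= spin_mapK.
Qed.

End Orientation.

(** * The group *)

Section Main.
Variable R : realType.
Local Open Scope group_scope.
Implicit Types (f g : homeo_plus R) (F G : int -> bool -> klein) (D E : pmap).

Lemma homeomorphismP (f g : R * R -> R * R) : continuous f -> continuous g ->
  cancel f g -> cancel g f -> homeomorphism f.
Proof. by move=> fc gc fK gK; split=> //; exists g. Qed.

Lemma scale_map_homeo v :
  homeomorphism (@scale_map R v) /\ orientation_preserving (@scale_map R v).
Proof.
split; last exact: scale_map_orientation.
apply: (@homeomorphismP _ (scale_map (- v)%R)).
- exact: scale_map_continuous.
- exact: scale_map_continuous.
- exact: scale_mapK.
- by have := @scale_mapK R (- v)%R; rewrite opprK.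
Qed.

Lemma spin_map_homeo s :
  homeomorphism (@spin_map R s) /\ orientation_preserving (@spin_map R s).
Proof.
split; last exact: spin_map_orientation.
apply: (@homeomorphismP _ (spin_map (- s)%R)).
- exact: spin_map_continuous.
- exact: spin_map_continuous.
- exact: spin_mapK.
- by have := @spin_mapK R (- s)%R; rewrite opprK.
Qed.

Lemma lens_map_homeo F :
  homeomorphism (@lens_map R F) /\ orientation_preserving (@lens_map R F).
Proof.
have VF k b : (F k b)^-1 * F k b = 1 by rewrite mulVg.
split; last exact: lens_map_orientation VF.
apply: (@homeomorphismP _ (lens_map (fun k b => (F k b)^-1))).
- exact: lens_map_continuous.
- exact: lens_map_continuous.
- exact: lens_mapK.
- by apply: lens_mapK => k b; rewrite mulgV.
Qed.

Definition homeo_c : homeo_plus R := HomeoPlus (scale_map_homeo 1).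
Definition homeo_d : homeo_plus R :=
  HomeoPlus (spin_map_homeo 1) * HomeoPlus (lens_map_homeo (plens pmap_d)).
Definition homeo_e : homeo_plus R := HomeoPlus (lens_map_homeo (plens pmap_e)).

Lemma homeo_realizesM D E f g :
  realizes D f -> realizes E g -> realizes (D * E) (f * g)%g.
Proof. exact: realizesM. Qed.

Lemma homeo_realizesV D f : realizes D f -> realizes D^-1 (f^-1)%g.
Proof.
move=> fD; apply: (realizesV fD) => z.
by have := congr1 (fun h : homeo_plus R => h z) (mulVg f).
Qed.

Lemma homeo_realizes1 : realizes 1 (1 : homeo_plus R)%g.
Proof. exact: realizes1. Qed.

Lemma homeo_realizesX D f n : realizes D f -> realizes (D ^+ n) (f ^+ n)%g.
Proof.
move=> fD; elim: n => [|n IH]; first exact: homeo_realizes1.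
by rewrite !expgS; apply: homeo_realizesM.
Qed.

Lemma homeo_realizes_uniq D E f g : realizes D f -> realizes E g -> D = E -> f = g.
Proof.
move=> fD gE DE; rewrite -DE in gE.
by apply: homeo_plus_ext; exact: realizes_uniq fD gE.
Qed.

Lemma homeo_c_realizes : realizes pmap_c homeo_c.
Proof. exact: scale_map_realizes. Qed.

Lemma homeo_d_realizes : realizes pmap_d homeo_d.
Proof.
have -> : pmap_d = Pmap 0 1 false (fun _ _ => 1) * Pmap 0 0 false (plens pmap_d).
  by apply: pmap_ext => // k b /=; rewrite mul1g.
apply: (homeo_realizesM (f := HomeoPlus (spin_map_homeo 1))).
  exact: spin_map_realizes.
exact: lens_map_realizes.
Qed.

Lemma homeo_e_realizes : realizes pmap_e homeo_e.
Proof. exact: lens_map_realizes. Qed.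

(** An overgroup of the one generated by [homeo_c], [homeo_d] and [homeo_e]; membership in it
    carries the parity condition from the generators to all elements. *)
Definition balanced_homeo : set (homeo_plus R) :=
  [set f | exists2 D, pmap_balanced D & realizes D f].

Lemma balanced_homeo_subgroup : subgroup balanced_homeo.
Proof.
split.
- by exists 1; [exact: pmap_balanced1|exact: homeo_realizes1].
- move=> f g [D bD fD] [E bE gE]; exists (D * E); first exact: pmap_balancedM.
  exact: homeo_realizesM.
- move=> f [D bD fD]; exists D^-1; first exact: pmap_balancedV.
  exact: homeo_realizesV.
Qed.

Lemma balanced_homeo_torsion_free : torsion_free balanced_homeo.
Proof.
move=> f n [D bD fD] n0 fn1; have := homeo_realizesX n fD; rewrite fn1 => fnD.
have D1 := pmap_torsion_free bD n0 (realizes_faithful fnD).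
exact: homeo_realizes_uniq fD homeo_realizes1 D1.
Qed.

Lemma smallest_subgroup (gT : groupType) (A : set gT) : subgroup (smallest (@subgroup _) A).
Proof.
split.
- by move=> H [[]].
- by move=> x y xA yA H HA; have [[_ HM _] _] := HA; apply: HM; [exact: xA|exact: yA].
- by move=> x xA H HA; have [[_ _ HV] _] := HA; apply: HV; exact: xA.
Qed.

End Main.

Theorem theorem4p4p3 (R : realType) :
  exists G : set (homeo_plus R),
    [/\ subgroup G, finitely_generated G, torsion_free G
      & ~ circularly_orderable G].
Proof.
pose A : set (homeo_plus R) := [set homeo_c R; homeo_d R; homeo_e R].
pose G := smallest (@subgroup _) A.
have cR := homeo_c_realizes R; have dR := homeo_d_realizes R.
have eR := homeo_e_realizes R.
have sG : subgroup G by exact: smallest_subgroup.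
have AG : A `<=` G by exact: sub_smallest.
have GW : G `<=` @balanced_homeo R.
  apply: smallest_sub; first exact: balanced_homeo_subgroup.
  move=> f [[->|->]|->].
  - by exists pmap_c => //; exact: pmap_c_balanced.
  - by exists pmap_d => //; exact: pmap_d_balanced.
  - by exists pmap_e => //; exact: pmap_e_balanced.
have tf : torsion_free G.
  by move=> f n /GW; exact: balanced_homeo_torsion_free.
exists G; split=> //.
  by exists A => //; rewrite /A !finite_setU; do !split; exact: finite_set1.
(* The relations hold between abstract elements and pass to the plane because a homeomorphism is
   determined by the element it realizes. *)
have bR := homeo_realizesM (homeo_realizesM (homeo_realizesM cR dR)
  (homeo_realizesV cR)) (homeo_realizesV dR); rewrite pmap_bE in bR.
have aR := homeo_realizesM (homeo_realizesM (homeo_realizesM eR cR)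
  (homeo_realizesV eR)) (homeo_realizesV cR); rewrite pmap_aE in aR.
have b2R := homeo_realizesX 2 bR; have a2R := homeo_realizesX 2 aR.
have ceR := homeo_realizesM (homeo_realizesM cR eR) (homeo_realizesV cR).
apply: (@not_circularly_orderable _ G (homeo_c R) (homeo_d R) (homeo_e R)) => //.
- by apply: AG; left; left.
- by apply: AG; left; right.
- by apply: AG; right.
- exact: homeo_realizes_uniq (homeo_realizesM bR dR) (homeo_realizesM dR bR) pmap_bd.
- exact: homeo_realizes_uniq (homeo_realizesM eR ceR) (homeo_realizesM ceR eR) pmap_ece.
- exact: homeo_realizes_uniq (homeo_realizesM (homeo_realizesM aR b2R)
    (homeo_realizesV aR)) (homeo_realizesV b2R) pmap_ab.
- exact: homeo_realizes_uniq (homeo_realizesM (homeo_realizesM bR a2R)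
    (homeo_realizesV bR)) (homeo_realizesV a2R) pmap_ba.
(* The identity would realize [pmap_b], which contains a half-turn. *)
- move=> b1; rewrite b1 in bR.
  by have := congr1 pturn (realizes_faithful bR).
Qed.
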